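(* Let $F:\mathbb{R}^n\rightrightarrows\mathbb{R}^n$ be a multifunction with Hamiltonian $H$ satisfying hypotheses (F1), (F2), (H1), (H2) of the context, and suppose that, for some $R>0$ and all $x\in\mathbb{R}^n$, the set $F(x)$ has the inner ball property of radius $R$. Let $\mathcal{S}\subset\mathbb{R}^n$ be nonempty and closed, let $T(\cdot)$ be the minimum time function to reach $\mathcal{S}$ for $\dot x\in F(x)$, let $\mathcal{C}=\{x\in\mathbb{R}^n\setminus\mathcal{S} : T(x)<+\infty\}$, and suppose $T(\cdot)$ is continuous in an open subset $\mathcal{O}$ of $\mathcal{C}$. Then there exists a continuous function $\rho_T(\cdot):\mathcal{O}\to(0,\infty)$ such that the hypograph of the restriction $T_{|\mathcal{O}}$ satisfies the $\rho_T(\cdot)$-exterior sphere condition.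
   Context: Let $H(x,p)=\sup_{v\in F(x)}\langle v,p\rangle$ for $(x,p)\in\mathbb{R}^n\times\mathbb{R}^n$. The hypotheses are: (F1) $F(x)$ is nonempty, convex and compact for each $x\in\mathbb{R}^n$. (F2) $F$ is Lipschitz continuous on $\mathbb{R}^n$ with respect to the Hausdorff distance. (H1) There is a constant $c_0\ge 0$ such that, for every $p$, $x\mapsto H(x,p)$ is semiconvex on $\mathbb{R}^n$ with constant $c_0|p|$, i.e. $H((1-\lambda)x_0+\lambda x_1,p)-(1-\lambda)H(x_0,p)-\lambda H(x_1,p)\le c_0|p|\lambda(1-\lambda)|x_1-x_0|^2$ for all $x_0,x_1\in\mathbb{R}^n$, $\lambda\in[0,1]$. (H2) For all $p\ne0$ and all $x$, the gradient $\nabla_pH(x,p)$ exists, and there is $K_1\ge0$ with $|\nabla_pH(x,p)-\nabla_pH(y,p)|\le K_1|y-x|$ for all $x,y\in\mathbb{R}^n$ and $p\neq0$. A trajectory from $x_0$ is an absolutely continuous $y:[0,\infty)\to\mathbb{R}^n$ with $y(0)=x_0$ and $\dot y(t)\in F(y(t))$ for a.e. $t\ge0$. Its transition time is $\theta(y)=\inf\{t\ge0 : y(t)\in\mathcal{S}\}\in[0,\infty]$, and $T(x_0)=\inf\{\theta(y) : y \text{ is a trajectory from } x_0\}\in[0,\infty]$. For a set $Q\subset\mathbb{R}^m$ and $x\in Q$, a vector $v\in\mathbb{R}^m$ is a proximal normal to $Q$ at $x$ (written $v\in N^P_Q(x)$) if there is $\sigma\ge0$ with $\langle v,y-x\rangle\le\sigma|y-x|^2$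 for all $y\in Q$; it is realized by a ball of radius $\rho>0$ if this holds with $\sigma=\frac{|v|}{2\rho}$. A closed set $Q\subset\mathbb{R}^n$ has the inner ball property of radius $R$ if, with $Q'$ the closure of $\mathbb{R}^n\setminus Q$, for every $x\in\partial Q$ there is a nonzero $v\in N^P_{Q'}(x)$ realized by a ball of radius $R$. For $f:\Omega\to\mathbb{R}$ with $\Omega\subset\mathbb{R}^n$ open, $\mathrm{hypo}(f)=\{(x,\beta) : x\in\Omega,\ \beta\le f(x)\}\subset\mathbb{R}^{n+1}$. Given a continuous $\theta:\Omega\to(0,\infty)$, $\mathrm{hypo}(f)$ satisfies the $\theta(\cdot)$-exterior sphere condition if for every $x\in\Omega$ there is a nonzero vector $v_x\in N^P_{\mathrm{hypo}(f)}(x,f(x))$ realized by a ball in $\mathbb{R}^{n+1}$ of radius $\theta(x)$. *)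

(* Defs.v *)
From HB Require Import structures.
From mathcomp Require Import all_boot all_order all_algebra.
From mathcomp Require Import all_classical all_reals all_analysis.

Set Implicit Arguments.
Unset Strict Implicit.
Unset Printing Implicit Defensive.

Import Order.TTheory GRing.Theory Num.Theory.
Import numFieldNormedType.Exports.

Local Open Scope classical_set_scope.
Local Open Scope ring_scope.

Section Euclidean.
Context {R : realType} {m : nat}.
Implicit Types (x y u v : 'rV[R]_m) (A B Q : set 'rV[R]_m).

Definition dotv u v : R := \sum_(i < m) u ord0 i * v ord0 i.

(* The library norm `|u| on 'rV[R]_m is the sup norm. It induces the same
   topology, but every metric notion below has to use the Euclidean norm. *)
Definition enorm u : R := Num.sqrt (dotv u u).

Definition edist_to x A : \bar R := ereal_inf [set (enorm (x - a))%:E | a in A].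

Definition hausdorff_dist A B : \bar R :=
  maxe (ereal_sup [set edist_to a B | a in A])
       (ereal_sup [set edist_to b A | b in B]).

Definition frontier Q : set 'rV[R]_m := closure Q `\` interior Q.

(* Partial derivatives only: meaningful where f is differentiable. *)
Definition grad (f : 'rV[R]_m -> R) x : 'rV[R]_m :=
  \row_i 'D_(delta_mx ord0 i) f x.

Definition semiconvex (f : 'rV[R]_m -> R) (c : R) :=
  forall x0 x1 (lambda : R), 0 <= lambda <= 1 ->
    f ((1 - lambda) *: x0 + lambda *: x1)
      - (1 - lambda) * f x0 - lambda * f x1
    <= c * lambda * (1 - lambda) * enorm (x1 - x0) ^+ 2.

Definition proximal_ineq Q x v (sigma : R) :=
  forall y, Q y -> dotv v (y - x) <= sigma * enorm (y - x) ^+ 2.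

Definition proximal_normal Q x v :=
  Q x /\ exists2 sigma : R, 0 <= sigma & proximal_ineq Q x v sigma.

Definition realized_by_ball Q x v (rho : R) :=
  0 < rho /\ proximal_ineq Q x v (enorm v / (2 * rho)).

Definition inner_ball_property Q (r : R) :=
  closed Q /\
  forall x, frontier Q x ->
    exists v, [/\ v != 0, proximal_normal (closure (~` Q)) x v
                & realized_by_ball (closure (~` Q)) x v r].

Definition absolutely_continuous (y : R -> 'rV[R]_m) (a b : R) :=
  forall e : R, 0 < e -> exists2 d : R, 0 < d &
    forall (k : nat) (s t : 'I_k -> R),
      (forall i, [/\ a <= s i, s i <= t i & t i <= b]) ->
      trivIset [set: 'I_k] (fun i => `]s i, t i[%classic) ->
      \sum_(i < k) (t i - s i) < d ->
      \sum_(i < k) enorm (y (t i) - y (s i)) < e.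

End Euclidean.

Section Dynamics.
Context {R : realType} {n : nat}.
Implicit Types (F : 'rV[R]_n -> set 'rV[R]_n) (S : set 'rV[R]_n).

Definition hamiltonian F (x p : 'rV[R]_n) : R :=
  sup [set dotv v p | v in F x].

Definition F1 F :=
  forall x, [/\ F x !=set0, convex_set (F x) & compact (F x)].

Definition F2 F :=
  exists2 L : R, 0 <= L &
    forall x y, (hausdorff_dist (F x) (F y) <= (L * enorm (x - y))%:E)%E.

Definition H1 F :=
  exists2 c0 : R, 0 <= c0 &
    forall p, semiconvex (fun x => hamiltonian F x p) (c0 * enorm p).

Definition H2 F :=
  (forall x p, p != 0 -> differentiable (hamiltonian F x) p) /\
  exists2 K1 : R, 0 <= K1 &
    forall x y p, p != 0 ->
      enorm (grad (hamiltonian F x) p - grad (hamiltonian F y) p)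
      <= K1 * enorm (y - x).

(* Trajectories live on [0, +oo); the values of y at negative times are
   irrelevant, since every condition concerns t >= 0 and {0} is negligible.
   Absolute continuity on the half-line is meant on every [0, b]. *)
Definition trajectory F (x0 : 'rV[R]_n) (y : R -> 'rV[R]_n) :=
  [/\ forall b : R, 0 <= b -> absolutely_continuous y 0 b,
      y 0 = x0
    & {ae (@lebesgue_measure R), forall t : R, 0 <= t ->
        derivable y t 1 /\ F (y t) ('D_1 y t)}].

Definition transition_time S (y : R -> 'rV[R]_n) : \bar R :=
  ereal_inf [set t%:E | t in [set t : R | 0 <= t /\ S (y t)]].

Definition min_time F S (x0 : 'rV[R]_n) : \bar R :=
  ereal_inf [set transition_time S y | y in [set y | trajectory F x0 y]].

(* The point (x, b) of R^n x R, identified with R^(n+1). *)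
Definition graph_pt (x : 'rV[R]_n) (b : R) : 'rV[R]_(n + 1) :=
  row_mx x b%:M.

Definition hypograph (Omega : set 'rV[R]_n) (f : 'rV[R]_n -> R)
    : set 'rV[R]_(n + 1) :=
  [set z | exists x b, [/\ Omega x, b <= f x & z = graph_pt x b]].

Definition exterior_sphere_condition (Omega : set 'rV[R]_n)
    (f theta : 'rV[R]_n -> R) :=
  forall x, Omega x ->
    exists v : 'rV[R]_(n + 1),
      [/\ v != 0, proximal_normal (hypograph Omega f) (graph_pt x (f x)) v
        & realized_by_ball (hypograph Omega f) (graph_pt x (f x)) v (theta x)].

End Dynamics.

(* Main.v *)
Require Import Defs.
From mathcomp Require Import all_boot all_order all_algebra.
From mathcomp Require Import all_classical all_reals all_analysis.
From mathcomp Require Import ring lra.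

Import Order.TTheory GRing.Theory Num.Theory.
Import numFieldNormedType.Exports.

Local Open Scope classical_set_scope.
Local Open Scope ring_scope.

(** An open ball that has [(x, T x)] on its boundary and is contained in the set of
    the [(y, b)] with [T y <= b] is an exterior sphere to the hypograph of the
    minimum time [T] at this point.  Such balls are constructed by following
    backwards, in short steps, a trajectory that starts at [x] and reaches [S] at a
    time close to [T x].

    Suppose that a ball with centre [E] is contained in [{(y, b) | T y <= b}] and
    contains a point [(xk, b)] of the trajectory.  Let [P] be the unit direction
    from [E] to this point and [N] the unit vector opposite to its space component.
    From a point [y], straight segments with velocities in [F y], run at a speed
    close to one, lead into the ball; by dynamic programming the points from which
    this succeeds satisfy [T y <= b] as well ([back_segment]).  They contain a ball
    with a larger radius, for three reasons.
    - By the inner ball property, [F y] contains the ball of radius [r] that touches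
      its boundary from inside at the maximizer [V y N] of [<N, .>]
      ([inner_ball_maximizer]), and so do the space-time velocities, with a smaller
      radius ([tilted_ball]).  This makes the radius grow at a positive rate.
    - By (H2) the maximizer [V y N], which is the gradient of the Hamiltonian
      ([grad_hamiltonian]), is Lipschitz in [y].  Away from the contact point this
      is all that is needed.
    - At the contact point first order errors matter, but only in direction [N],
      where [<N, V y N>] is the Hamiltonian.  By (H1) it is bounded below by an
      affine function up to a quadratic error ([semiconvex_support]).  The affine
      part is compensated by tilting the ball, the quadratic part by a small loss of
      radius ([ball_push]).
    The previous trajectory point stays in the new ball up to second order terms:
    the velocity of the trajectory is at most as large in direction [N] as the
    maximizer ([U_radial]), and this gives [backward_step].

    Adding up the steps and letting their length tend to zero, one obtains balls
    with a radius proportional to the time [tau] travelled, which contain the point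
    [(x, T x)] up to an arbitrarily small error ([tracked_all]).  Inside them there
    are balls with half the radius whose boundary passes through the point, and a
    compactness argument removes the error ([touching_ball_limit]).  The radius only
    depends on [T x], the constants of the hypotheses and a bound for [F] near [x],
    and can be taken continuous in [x]. *)

(** * Euclidean geometry *)

Lemma small_enough {R : realFieldType} (C a c : R) : 0 <= C -> 0 < a -> 0 < c ->
  exists x, [/\ 0 < x, x <= a & C * x <= c].
Proof.
move=> C0 a0 cp; have C1 : 0 < C + 1 by lra.
exists (Num.min a (c / (C + 1))); split.
- by rewrite lt_min a0 divr_gt0.
- by rewrite ge_min lexx.
set x := Num.min _ _; have x0 : 0 < x by rewrite lt_min a0 divr_gt0.
have : x <= c / (C + 1) by rewrite ge_min lexx orbT.
by rewrite ler_pdivlMr //; lra.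
Qed.

Section EuclideanLemmas.
Context {R : realType} {m : nat}.
Implicit Types (u v w : 'rV[R]_m) (a b : R).

Lemma dotvC u v : dotv u v = dotv v u.
Proof. by apply: eq_bigr => i _; rewrite mulrC. Qed.

Lemma dotvDl u v w : dotv (u + v) w = dotv u w + dotv v w.
Proof. by rewrite -big_split; apply: eq_bigr => i _; rewrite mxE mulrDl. Qed.

Lemma dotvZl a u v : dotv (a *: u) v = a * dotv u v.
Proof. by rewrite mulr_sumr; apply: eq_bigr => i _; rewrite mxE mulrA. Qed.

Lemma dotvDr u v w : dotv u (v + w) = dotv u v + dotv u w.
Proof. by rewrite dotvC dotvDl !(dotvC u). Qed.

Lemma dotvZr a u v : dotv u (a *: v) = a * dotv u v.
Proof. by rewrite dotvC dotvZl dotvC. Qed.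

Lemma dotvNl u v : dotv (- u) v = - dotv u v.
Proof. by rewrite -scaleN1r dotvZl mulN1r. Qed.

Lemma dotvNr u v : dotv u (- v) = - dotv u v.
Proof. by rewrite dotvC dotvNl dotvC. Qed.

Lemma dotv0l u : dotv 0 u = 0.
Proof. by rewrite -(scale0r 0) dotvZl mul0r. Qed.

Lemma dotv0r u : dotv u 0 = 0.
Proof. by rewrite dotvC dotv0l. Qed.

Definition dotvE := (dotvDl, dotvDr, dotvNl, dotvNr, dotvZl, dotvZr).

Lemma dotvv_ge0 u : 0 <= dotv u u.
Proof. by apply: sumr_ge0 => i _; rewrite -expr2 sqr_ge0. Qed.

Lemma dotvv_eq0 u : dotv u u = 0 -> u = 0.
Proof.
move=> /eqP; rewrite psumr_eq0 => [/allP u0|i _]; last by rewrite -expr2 sqr_ge0.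
apply/rowP => i; have := u0 i (mem_index_enum i).
by rewrite mxE -expr2 sqrf_eq0 => /eqP.
Qed.

Lemma enorm_ge0 u : 0 <= enorm u. Proof. exact: sqrtr_ge0. Qed.

Lemma enorm_sqr u : enorm u ^+ 2 = dotv u u.
Proof. by rewrite sqr_sqrtr // dotvv_ge0. Qed.

Lemma enorm0 : enorm (0 : 'rV[R]_m) = 0.
Proof. by rewrite /enorm dotv0l sqrtr0. Qed.

Lemma enorm_eq0 u : (enorm u == 0) = (u == 0).
Proof.
apply/eqP/eqP => [u0|->]; last exact: enorm0.
by apply: dotvv_eq0; rewrite -enorm_sqr u0 expr0n.
Qed.

Lemma enorm_gt0 u : (0 < enorm u) = (u != 0).
Proof. by rewrite lt_def enorm_ge0 andbT enorm_eq0. Qed.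

Lemma enormZ a u : enorm (a *: u) = `|a| * enorm u.
Proof.
by rewrite /enorm dotvZl dotvZr mulrA -expr2 sqrtrM ?sqr_ge0 // sqrtr_sqr.
Qed.

Lemma enormN u : enorm (- u) = enorm u.
Proof. by rewrite /enorm dotvNl dotvNr opprK. Qed.

Lemma enormBC u v : enorm (u - v) = enorm (v - u).
Proof. by rewrite -enormN opprB. Qed.

Lemma enorm_le a u : 0 <= a -> (enorm u <= a) = (dotv u u <= a ^+ 2).
Proof. by move=> a0; rewrite -enorm_sqr ler_pXn2r // nnegrE enorm_ge0. Qed.

Lemma cauchy_schwarz u v : dotv u v <= enorm u * enorm v.
Proof.
have [->|] := eqVneq u 0; first by rewrite dotv0l enorm0 mul0r.
have [->|] := eqVneq v 0; first by rewrite dotv0r enorm0 mulr0.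
rewrite -!enorm_gt0 => v0 u0.
have := dotvv_ge0 (enorm v *: u - enorm u *: v).
rewrite !dotvE (dotvC v u) -!enorm_sqr => h.
have : 0 <= 2 * (enorm u * enorm v) * (enorm u * enorm v - dotv u v) by lra.
by rewrite pmulr_rge0 ?subr_ge0 // mulr_gt0 // mulr_gt0.
Qed.

Lemma cauchy_schwarzN u v : - (enorm u * enorm v) <= dotv u v.
Proof. by have := cauchy_schwarz (- u) v; rewrite dotvNl enormN; lra. Qed.

Lemma enormD u v : enorm (u + v) <= enorm u + enorm v.
Proof.
rewrite enorm_le ?addr_ge0 ?enorm_ge0 // !dotvE (dotvC v u) -!enorm_sqr.
by have := cauchy_schwarz u v; lra.
Qed.

Lemma enormB u v : enorm (u - v) <= enorm u + enorm v.
Proof. by rewrite -(enormN v) enormD. Qed.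

Lemma enorm_triangle u v w : enorm (u - w) <= enorm (u - v) + enorm (v - w).
Proof. by have := enormD (u - v) (v - w); rewrite addrA subrK. Qed.

(** Polar form; the default direction makes it available at the origin. *)
Lemma polar u (e : 'rV[R]_m) : enorm e = 1 ->
  exists2 nu : 'rV[R]_m, enorm nu = 1 & u = enorm u *: nu.
Proof.
move=> e1; have [->|u0] := eqVneq u 0; first by exists e; rewrite // enorm0 scale0r.
have n0 : enorm u != 0 by rewrite enorm_eq0.
exists ((enorm u)^-1 *: u); last by rewrite scalerA divff // scale1r.
by rewrite enormZ ger0_norm ?invr_ge0 ?enorm_ge0 // mulVf.
Qed.

(** Comparison with the sup norm carries the topology of row vectors over to
    Euclidean balls. *)
Lemma enorm_le_norm u : enorm u <= Num.sqrt m%:R * `|u|.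
Proof.
rewrite enorm_le ?mulr_ge0 ?sqrtr_ge0 // exprMn sqr_sqrtr ?ler0n //.
apply: (@le_trans _ _ (\sum_(i < m) `|u| ^+ 2)).
  apply: ler_sum => i _; rewrite -expr2 -real_normK ?num_real //.
  rewrite ler_pXn2r ?nnegrE // [leRHS]/Num.norm /= mx_normrE.
  by apply: (le_bigmax _ (fun ij => `|u ij.1 ij.2|) (ord0, i)).
by rewrite sumr_const card_ord mulr_natl.
Qed.

Lemma norm_le_enorm u : `|u| <= enorm u.
Proof.
rewrite {1}/Num.norm /= mx_normrE; apply/bigmax_leP; split=> [|[i j] _ /=].
  exact: enorm_ge0.
rewrite -(ler_pXn2r (n := 2)) // ?nnegrE ?enorm_ge0 //.
rewrite real_normK ?num_real // enorm_sqr /dotv (bigD1 j) //= (ord1 i) -expr2.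
by rewrite lerDl; apply: sumr_ge0 => k _; rewrite -expr2 sqr_ge0.
Qed.

Lemma nbhs_enorm u (e : R) : 0 < e -> nbhs u [set w | enorm (u - w) <= e].
Proof.
move=> e0; have C0 : 0 < Num.sqrt m%:R + 1 :> R by rewrite ltr_wpDl ?sqrtr_ge0.
have d0 : 0 < e / (Num.sqrt m%:R + 1) by rewrite divr_gt0.
apply: (@filterS _ _ (nbhs_filter u) _ _ _ (nbhsx_ballx u _ d0)) => w.
rewrite -ball_normE /= => /ltW h; apply: (le_trans (enorm_le_norm _)).
move: h; rewrite ler_pdivlMr // mulrDr mulr1 => h.
by apply: le_trans h; rewrite mulrC lerDl.
Qed.

Lemma enorm_continuous : continuous (enorm : 'rV[R]_m -> R).
Proof.
move=> u; apply/(@cvgrPdist_le _ _ _ _ (nbhs_filter u)) => e e0.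
near=> w; have k : enorm (u - w) <= e by near: w; exact: nbhs_enorm.
rewrite ler_norml; have := enormD (u - w) w; have := enormD (w - u) u.
by rewrite !subrK (enormBC w u); lra.
Unshelve. all: by end_near. Qed.

Lemma dotv_continuous u : continuous (dotv u).
Proof.
move=> v; apply/(@cvgrPdist_le _ _ _ _ (nbhs_filter v)) => e e0.
have C0 : 0 < enorm u + 1 by rewrite ltr_wpDl ?enorm_ge0.
have d0 : 0 < e / (enorm u + 1) by rewrite divr_gt0.
near=> w; have : enorm (v - w) <= e / (enorm u + 1) by near: w; exact: nbhs_enorm.
rewrite ler_pdivlMr // => h; have n0 := enorm_ge0 (v - w).
rewrite -dotvNr -dotvDr ler_norml.
have := cauchy_schwarz u (v - w); have := cauchy_schwarzN u (v - w).
by nra.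
Unshelve. all: by end_near. Qed.

Lemma nbhs_enormP u (A : set 'rV[R]_m) : nbhs u A ->
  exists2 d : R, 0 < d & forall w, enorm (u - w) < d -> A w.
Proof.
move=> /nbhs_ballP[d /= d0 hd]; exists d => // w hw; apply: hd.
by rewrite -ball_normE /=; apply: le_lt_trans hw; exact: norm_le_enorm.
Qed.

Lemma closed_enorm (A : set 'rV[R]_m) u : closed A ->
  (forall d : R, 0 < d -> exists2 w, A w & enorm (u - w) < d) -> A u.
Proof.
move=> Acl h; apply: Acl => B /nbhs_enormP[d d0 hd].
by have [w Aw /hd Bw] := h _ d0; exists w.
Qed.

End EuclideanLemmas.

Section Graph.
Context {R : realType} {n : nat}.
Implicit Types (x y : 'rV[R]_n) (b c : R).

Lemma dotv_graph x y b c :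
  dotv (graph_pt x b) (graph_pt y c) = dotv x y + b * c.
Proof.
rewrite /dotv big_split_ord /=; congr (_ + _).
  by apply: eq_bigr => i _; rewrite !row_mxEl.
by rewrite big_ord1 !row_mxEr !mxE !mulr1n.
Qed.

Lemma graph_ptD x y b c :
  graph_pt x b + graph_pt y c = graph_pt (x + y) (b + c).
Proof. by rewrite /graph_pt add_row_mx raddfD. Qed.

Lemma graph_ptN x b : - graph_pt x b = graph_pt (- x) (- b).
Proof. by rewrite /graph_pt opp_row_mx raddfN. Qed.

Lemma graph_ptZ a x b : a *: graph_pt x b = graph_pt (a *: x) (a * b).
Proof. by rewrite /graph_pt scale_row_mx scale_scalar_mx. Qed.

Definition graph_ptE := (graph_ptD, graph_ptN, graph_ptZ).

Lemma graph_pt_surj (z : 'rV[R]_(n + 1)) : exists x b, z = graph_pt x b.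
Proof.
exists (lsubmx z), (rsubmx z ord0 ord0).
rewrite /graph_pt -{1}(hsubmxK z); congr row_mx.
by apply/rowP => i; rewrite (ord1 i) !mxE mulr1n.
Qed.

Lemma enorm_graphl x b : enorm x <= enorm (graph_pt x b).
Proof.
rewrite enorm_le ?enorm_ge0 // enorm_sqr dotv_graph lerDl.
by rewrite -expr2 sqr_ge0.
Qed.

Lemma enorm_graph_le x b : enorm (graph_pt x b) <= enorm x + `|b|.
Proof.
have x0 := enorm_ge0 x; have b0 := normr_ge0 b.
rewrite enorm_le ?addr_ge0 // dotv_graph -enorm_sqr -expr2.
rewrite -(real_normK (num_real b)); nra.
Qed.

Lemma enorm_graph0 x : enorm (graph_pt x 0) = enorm x.
Proof. by rewrite /enorm dotv_graph mulr0 addr0. Qed.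

End Graph.


(** * Balls and displacements *)

Section BallGeometry.
Context {R : realType} {m : nat}.
Implicit Types (P Z D J W : 'rV[R]_m) (h K : R).

Lemma ball_sum W (a b : R) : 0 <= a -> 0 <= b -> enorm W <= a + b ->
  exists2 Q : 'rV[R]_m, enorm Q <= b & enorm (W + Q) <= a.
Proof.
move=> a0 b0 hW; have [Wb|bW] := leP (enorm W) b.
  by exists (- W); rewrite ?enormN // subrr enorm0.
have W0 : 0 < enorm W by lra.
exists (- (b / enorm W) *: W).
  by rewrite enormZ normrN ger0_norm ?divr_ge0 ?enorm_ge0 // divfK ?lt0r_neq0.
rewrite -[X in X + _]scale1r -scalerDl enormZ ger0_norm; last first.
  by rewrite subr_ge0 ler_pdivrMr // mul1r ltW.
by rewrite mulrBl mul1r divfK ?lt0r_neq0 //; lra.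
Qed.

(** A ball of radius [rho] is transported by the displacement [h (D - G)], where
    [D] varies with the point [Z].  Only two facts on [D] are available: its size,
    and a lower bound on its inward component [- <P, D>] near the contact point
    [rho P].  The linear term of that bound is cancelled by the part of [G] along
    [zeta], which amounts to tilting the ball.  The remaining quadratic terms in
    [W = Z - rho P] are absorbed by the part of [G] along [P]: moving the centre
    by [s P] while the radius shrinks by [s] leaves the contact point fixed and
    gains [s |W|^2 / (2 rho)] on the rest of the sphere. *)
Lemma ball_push P Z D J zeta (rho p w j h K Gam : R) :
  enorm P = 1 -> enorm Z <= rho -> 0 <= rho <= 1 -> 0 <= p <= 1 -> 1 <= K ->
  0 <= h -> enorm zeta <= 3 * K ->
  0 <= w -> enorm D <= K * w -> w <= enorm (Z - rho *: P) + enorm J ->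
  - dotv P D >= p * (dotv zeta ((Z - rho *: P) + J) - K * w ^+ 2 - K * h) ->
  enorm J <= j -> j <= 1 -> 0 <= Gam -> j <= Gam * rho ->
  let theta := p * dotv zeta P + 10 * K ^+ 2 in
  let G := - (rho * p) *: zeta - (10 * K ^+ 2 * rho) *: P in
  let mu := rho * theta + 9 * K ^+ 2 * j
    + (K + (15 * K ^+ 2 + K * Gam) ^+ 2 / 2) * h - K ^+ 2 * w ^+ 2 in
  0 <= rho + h * mu ->
  enorm (Z + h *: (D - G)) <= rho + h * mu.
Proof.
move=> P1 Zr /andP[r0 r1] /andP[p0 p1] K1 h0 z3 w0 Dw wW PD Jj j1 Gam0 jG theta G mu mu0.
have PP : dotv P P = 1 by rewrite -enorm_sqr P1 expr1n.
set W := Z - rho *: P in wW PD.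
have ZE : Z = W + rho *: P by rewrite subrK.
have W0 := enorm_ge0 W; have J0 := enorm_ge0 J.
have j0 : 0 <= j by lra.
have W2 : enorm W <= 2 * rho.
  apply: le_trans (enormB _ _) _; rewrite enormZ P1 mulr1 ger0_norm //; lra.
have K0 : 0 <= K by lra.
have KK : K <= K ^+ 2 by rewrite expr2 ler_peMl.
have wWj : w <= enorm W + j by lra.
have WW : enorm W ^+ 2 = dotv W W by rewrite enorm_sqr.
(* half-space form of membership in the ball *)
have ZZ : dotv W W + 2 * rho * dotv W P <= 0.
  move: Zr; rewrite enorm_le // ZE; clearbody W; rewrite !dotvE PP (dotvC P W); nra.
have WD : dotv W D <= K * enorm W ^+ 2 + 2 * K * rho * j.
  have h1 := cauchy_schwarz W D.
  have h2 : enorm W * enorm D <= enorm W * (K * w) by rewrite ler_wpM2l.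
  have h3 : enorm W * (K * w) <= enorm W * (K * (enorm W + j)) by rewrite !ler_wpM2l.
  have h4 : enorm W * (K * j) <= 2 * rho * (K * j).
    by rewrite ler_wpM2r // mulr_ge0.
  rewrite expr2; lra.
have w2 : w ^+ 2 <= 2 * enorm W ^+ 2 + 2 * j.
  have h1 : w ^+ 2 <= (enorm W + j) ^+ 2 by rewrite ler_pXn2r ?nnegrE ?addr_ge0.
  have h2 : j ^+ 2 <= j by rewrite expr2 ler_piMl.
  have := sqr_ge0 (enorm W - j); rewrite !expr2 in h1 h2 *; lra.
have zJ : - (p * dotv zeta J) <= 3 * K * j.
  have h1 := cauchy_schwarzN zeta J.
  have h2 : enorm zeta * enorm J <= 3 * K * j.
    by apply: ler_pM; rewrite ?enorm_ge0.
  have n0 : 0 <= enorm zeta * enorm J by rewrite mulr_ge0 ?enorm_ge0.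
  have : p * (- dotv zeta J) <= p * (enorm zeta * enorm J) by rewrite ler_wpM2l //; lra.
  have : p * (enorm zeta * enorm J) <= enorm zeta * enorm J by rewrite ler_piMl.
  lra.
have DG : enorm (D - G) <= (15 * K ^+ 2 + K * Gam) * rho.
  have h1 : enorm G <= 13 * K ^+ 2 * rho.
    apply: le_trans (enormB _ _) _; rewrite !enormZ normrN P1 mulr1.
    rewrite (ger0_norm (mulr_ge0 r0 p0)) ger0_norm; last by rewrite !mulr_ge0.
    have : rho * p * enorm zeta <= rho * (3 * K).
      apply: ler_pM; rewrite ?mulr_ge0 ?enorm_ge0 //.
      by rewrite ler_piMr.
    have : rho * K <= rho * K ^+ 2 by rewrite ler_wpM2l.
    lra.
  apply: le_trans (enormB _ _) _; have h2 : K * w <= K * (2 * rho + j) by rewrite ler_wpM2l //; lra.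
  have h3 : K * j <= K * (Gam * rho) by rewrite ler_wpM2l.
  have h4 : K * rho <= K ^+ 2 * rho by rewrite ler_wpM2r.
  lra.
have DG2 : dotv (D - G) (D - G) <= (15 * K ^+ 2 + K * Gam) ^+ 2 * rho.
  rewrite -enorm_sqr.
  have h1 : enorm (D - G) ^+ 2 <= ((15 * K ^+ 2 + K * Gam) * rho) ^+ 2.
    by rewrite ler_pXn2r ?nnegrE ?enorm_ge0 // mulr_ge0 // addr_ge0 // mulr_ge0 ?sqr_ge0.
  apply: le_trans h1 _; rewrite exprMn ler_wpM2l ?sqr_ge0 // expr2 ler_piMl //.
have main : dotv Z (D - G) + h / 2 * dotv (D - G) (D - G) <= rho * mu.
  have h1 : h / 2 * dotv (D - G) (D - G) <= h / 2 * ((15 * K ^+ 2 + K * Gam) ^+ 2 * rho).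
    by rewrite ler_wpM2l // divr_ge0.
  have h2 : dotv Z (D - G) = dotv W D + rho * dotv P D + rho * p * dotv zeta W
      + rho * p * rho * dotv zeta P + 10 * K ^+ 2 * rho * (dotv W P + rho).
    rewrite /G ZE; clearbody W; rewrite !dotvE PP (dotvC W zeta) (dotvC P zeta); ring.
  have h3 : rho * (dotv P D) <= rho * (- (p * (dotv zeta (W + J) - K * w ^+ 2 - K * h))).
    by rewrite ler_wpM2l //; lra.
  have h4 : 5 * K ^+ 2 * (dotv W W + 2 * rho * dotv W P) <= 0.
    by rewrite mulr_ge0_le0 // mulr_ge0 ?sqr_ge0.
  have h5 : rho * (p * (K * w ^+ 2)) <= rho * (K ^+ 2 * w ^+ 2).
    rewrite ler_wpM2l //; apply: (@le_trans _ _ (K * w ^+ 2)).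
      by rewrite ler_piMl // mulr_ge0 ?sqr_ge0.
    by rewrite ler_wpM2r ?sqr_ge0.
  have h6 : rho * (p * (K * h)) <= rho * (K * h).
    by rewrite ler_wpM2l // ler_piMl // mulr_ge0.
  have h7 : rho * (- (p * dotv zeta J)) <= rho * (3 * K * j) by rewrite ler_wpM2l.
  have h8 : rho * K ^+ 2 * w ^+ 2 <= rho * K ^+ 2 * (2 * enorm W ^+ 2 + 2 * j).
    by rewrite ler_wpM2l // mulr_ge0 ?sqr_ge0.
  have h9 : rho * K ^+ 2 * enorm W ^+ 2 <= K ^+ 2 * enorm W ^+ 2.
    by rewrite -mulrA ler_piMl // mulr_ge0 ?sqr_ge0.
  have h10 : K * enorm W ^+ 2 <= K ^+ 2 * enorm W ^+ 2.
    by rewrite ler_wpM2r ?sqr_ge0.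
  have h11 : rho * j * K <= rho * j * K ^+ 2 by rewrite ler_wpM2l // mulr_ge0.
  rewrite h2 /mu /theta; rewrite dotvDr in h3; rewrite WW in h8 h9 h10 WD.
  clear -h1 h3 h4 h5 h6 h7 h8 h9 h10 h11 WD.
  move: h1 h3 h4 h5 h6 h7 h8 h9 h10 h11 WD.
  set dd := dotv (D - G) (D - G); clearbody dd; lra.
rewrite enorm_le //.
have -> : dotv (Z + h *: (D - G)) (Z + h *: (D - G)) =
    dotv Z Z + 2 * h * (dotv Z (D - G) + h / 2 * dotv (D - G) (D - G)).
  by move: (D - G) => X; rewrite !dotvE (dotvC X Z); lra.
have h1 : dotv Z Z <= rho ^+ 2 by rewrite -enorm_le.
have h2 : 2 * h * (dotv Z (D - G) + h / 2 * dotv (D - G) (D - G)) <= 2 * h * (rho * mu).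
  by rewrite ler_wpM2l // mulr_ge0.
have := sqr_ge0 (h * mu); rewrite !expr2 in h1 *; lra.
Qed.

(** To first order the distance to a center changes by the radial component of
    the displacement. *)
Lemma radial_displacement P (U : 'rV[R]_m) (l h chi c : R) :
  enorm P = 1 -> 0 < l -> 0 <= h -> 0 <= chi -> dotv P U <= chi ->
  enorm U <= c ->
  enorm (l *: P + h *: U) <= l + h * chi + h ^+ 2 * c ^+ 2 / (2 * l).
Proof.
move=> P1 l0 h0 chi0 PU Uc.
have PP : dotv P P = 1 by rewrite -enorm_sqr P1 expr1n.
set e := _ / _; have e0 : 0 <= e.
  apply: divr_ge0; first by rewrite mulr_ge0 ?sqr_ge0.
  by rewrite mulr_ge0 // ltW.
have le2 : 2 * l * e = h ^+ 2 * c ^+ 2.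
  by rewrite /e mulrC divfK // mulf_neq0 // lt0r_neq0.
have c0 : 0 <= c by apply: le_trans Uc; exact: enorm_ge0.
have hc : 0 <= h * chi by rewrite mulr_ge0.
rewrite enorm_le; last by rewrite !addr_ge0 // ltW.
have UU : dotv U U <= c ^+ 2 by rewrite -enorm_le.
rewrite !dotvE PP (dotvC U P).
have h1 : h ^+ 2 * dotv U U <= h ^+ 2 * c ^+ 2 by rewrite ler_wpM2l ?sqr_ge0.
have h2 : 2 * l * h * dotv P U <= 2 * l * h * chi.
  by rewrite ler_wpM2l // !mulr_ge0 //; exact: ltW.
have h3 := sqr_ge0 (h * chi + e).
rewrite !expr2 in h1 h3 le2 *; lra.
Qed.

End BallGeometry.

(** * Compactness and semiconvexity *)

Section Compactness.
Context {R : realType} {m : nat}.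

Lemma compact_eball (c : 'rV[R]_m) (a : R) :
  compact [set u | enorm (u - c) <= a].
Proof.
apply: bounded_closed_compact.
  exists (a + enorm c); split; first exact: num_real.
  move=> B hB u /= uc; apply: le_trans (ltW hB); apply: le_trans (norm_le_enorm _) _.
  by have := enormD (u - c) c; rewrite subrK; lra.
move=> u hu; apply/ler_addgt0Pr => e e0.
have [w [/= wc uw]] := hu _ (nbhs_enorm u e e0).
by have := enorm_triangle u w c; lra.
Qed.

Lemma lipschitz_continuous (f : 'rV[R]_m -> R) (K : R) : 0 <= K ->
  (forall u v, f u - f v <= K * enorm (u - v)) -> continuous f.
Proof.
move=> K0 hf u; apply/(@cvgrPdist_le _ _ _ _ (nbhs_filter u)) => e e0.
have d0 : 0 < e / (K + 1) by rewrite divr_gt0 //; lra.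
near=> w; have : enorm (u - w) <= e / (K + 1) by near: w; exact: nbhs_enorm.
have n0 := enorm_ge0 (u - w).
rewrite ler_pdivlMr => [h|]; last by lra.
rewrite ler_norml; have := hf u w; have := hf w u; rewrite (enormBC w); nra.
Unshelve. all: by end_near. Qed.

(** Proximal regularization: the penalized convex function [g + k |. - x|^2] has
    a minimizer, the opposite of the gradient of the penalty there is a subgradient
    of [g], and the minimizer tends to [x] as [k] grows. *)
Lemma semiconvex_support (f : 'rV[R]_m -> R) (c K eta : R) x :
  0 <= c -> 0 <= K -> 0 < eta ->
  semiconvex f c -> (forall u v, f u - f v <= K * enorm (u - v)) ->
  exists zeta, forall y,
    f x + dotv zeta (y - x) - c * enorm (y - x) ^+ 2 - eta <= f y.
Proof.
move=> c0 K0 eta0 fsc fL.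
pose k := (2 * K + 1) ^+ 2 / eta + (2 * K + 1).
have k_gt0 : 0 < k by rewrite ltr_wpDl ?divr_ge0 ?sqr_ge0 ?ltW //; lra.
have kK : 2 * K < k by rewrite ltr_wpDl ?divr_ge0 ?sqr_ge0 ?ltW //; lra.
have keta : K ^+ 2 <= k * eta.
  rewrite mulrDl divfK ?lt0r_neq0 //; nra.
pose g y := f y + c * dotv (y - x) (y - x).
pose phi y := g y + k * dotv (y - x) (y - x).
have cn : continuous (fun y : 'rV[R]_m => enorm (y - x)).
  apply: (lipschitz_continuous _ 1) => // u v; rewrite mul1r.
  by have := enorm_triangle u v x; lra.
have cphi : continuous phi.
  have -> : phi = (fun y => f y + c * (enorm (y - x) * enorm (y - x)) +
      k * (enorm (y - x) * enorm (y - x))).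
    by apply/funext => w; rewrite /phi /g -enorm_sqr.
  move=> y; have Fy := nbhs_filter y.
  have c2 := cvgM (cn y) (cn y); have {}c2 := c2 Fy.
  have c3 a : (fun w => a * (enorm (w - x) * enorm (w - x))) @ y -->
      a * (enorm (y - x) * enorm (y - x)).
    by apply: cvgM c2; exact: cvg_cst.
  have c4 : (fun w => f w + c * (enorm (w - x) * enorm (w - x))) @ y -->
      f y + c * (enorm (y - x) * enorm (y - x)).
    by apply: cvgD (c3 c); exact: (lipschitz_continuous f K K0 fL y).
  by apply: cvgD (c3 k); exact: c4.
have ball0 : [set u | enorm (u - x) <= 1] !=set0 by exists x; rewrite /= subrr enorm0.
have [z + hz] := EVT_min_rV ball0 (compact_eball x 1) (continuous_subspaceT cphi).
rewrite inE /= => zx; have {}hz y : enorm (y - x) <= 1 -> phi z <= phi y.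
  by move=> yx; apply: hz; rewrite inE.
have nz : k * enorm (z - x) <= K.
  have := hz x; rewrite subrr enorm0 => /(_ ler01).
  rewrite /phi /g subrr dotv0l !mulr0 !addr0 -enorm_sqr => h.
  have := fL x z; rewrite enormBC => h'.
  have n0 := enorm_ge0 (z - x).
  have [->|nz0] := eqVneq (enorm (z - x)) 0; first by rewrite mulr0.
  have n1 : 0 < enorm (z - x) by rewrite lt_def nz0.
  rewrite -(ler_pM2r n1).
  have : 0 <= c * enorm (z - x) ^+ 2 by rewrite mulr_ge0 ?sqr_ge0.
  lra.
have zx2 : enorm (z - x) <= 1 / 2.
  by rewrite -(ler_pM2l k_gt0); lra.
exists (- (2 * k) *: (z - x)) => y.
pose Z := z - x; pose D := y - z.
have yE : y - x = D + Z by rewrite addrA subrK.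
(* comparison with the minimizer along the segment towards y *)
have key lam : 0 < lam <= 1 -> lam * enorm D <= 1 / 2 ->
    g z - 2 * k * dotv Z D - k * lam * dotv D D <= g y.
  move=> /andP[l0 l1] lD.
  have wE : (1 - lam) *: z + lam *: y = x + (Z + lam *: D).
    by apply/rowP => j; rewrite !mxE; ring.
  have := hz (x + (Z + lam *: D)); rewrite addrC addKr.
  have -> : enorm (Z + lam *: D) <= 1.
    by apply: le_trans (enormD _ _) _; rewrite enormZ gtr0_norm //; rewrite /Z; lra.
  move=> /(_ isT).
  have /fsc : 0 <= lam <= 1 by rewrite l1 ltW.
  move=> /(_ z y); rewrite wE /phi /g (addrC x) addrK yE -/Z -/D.
  rewrite enorm_sqr; clearbody Z D; rewrite !dotvE (dotvC D Z) => h1 h2.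
  rewrite -(ler_pM2l l0); clear -h1 h2; lra.
have {}key : g z - 2 * k * dotv Z D <= g y.
  apply/ler_addgt0Pr => e e0.
  pose B := k * dotv D D + 2 * enorm D + e + 1.
  have DD := dotvv_ge0 D; have nD := enorm_ge0 D.
  have kDD : 0 <= k * dotv D D by rewrite mulr_ge0 // ltW.
  have B0 : 0 < B by rewrite /B; lra.
  pose lam := Num.min 1 e / B.
  have m0 : 0 < Num.min 1 e by rewrite lt_min ltr01.
  have m1 : Num.min 1 e <= 1 by rewrite ge_min lexx.
  have me : Num.min 1 e <= e by rewrite ge_min lexx orbT.
  have lam0 : 0 < lam by rewrite divr_gt0.
  have lamB : lam * B = Num.min 1 e by rewrite divfK // lt0r_neq0.
  have h1 : lam * (k * dotv D D) <= lam * B by rewrite ler_pM2l // /B; lra.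
  have h2 : lam * (2 * enorm D) <= lam * B by rewrite ler_pM2l // /B; lra.
  have h3 : lam * 1 <= lam * B by rewrite ler_pM2l // /B; lra.
  have /key : 0 < lam <= 1 by rewrite lam0; lra.
  by move=> /(_ ltac:(lra)); lra.
have := fL x z; rewrite enormBC -/Z => h.
have ZZ : dotv Z Z = enorm Z ^+ 2 by rewrite enorm_sqr.
have nZ := enorm_ge0 Z; rewrite -/Z in nz.
have KZ : K * enorm Z <= eta.
  rewrite -(ler_pM2l k_gt0); have : K * (k * enorm Z) <= K * K by rewrite ler_wpM2l.
  lra.
have cZ : 0 <= c * enorm Z ^+ 2 by rewrite mulr_ge0 ?sqr_ge0.
have kZ : 0 <= k * enorm Z ^+ 2 by rewrite mulr_ge0 ?sqr_ge0 // ltW.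
move: key; rewrite /g yE -/Z enorm_sqr; clearbody Z D; rewrite !dotvE ZZ; lra.
Qed.

End Compactness.


Section TouchingBalls.
Context {R : realType} {m : nat}.
Implicit Types (X Y E nu : 'rV[R]_m).

(** Halving the radius makes room to let the ball touch a prescribed point of the
    bigger ball. *)
Lemma touching_ball X E e1 (rho a e : R) : enorm (e1 : 'rV[R]_m) = 1 ->
  0 <= e -> 2 * a <= rho -> enorm (X - E) <= rho + e ->
  exists2 nu : 'rV[R]_m, enorm nu = 1 & forall Y,
    enorm (Y - (X + a *: nu)) <= a - e -> enorm (Y - E) <= rho.
Proof.
move=> e11 e0 ar XE; have [nu nu1 EX] := polar (E - X) _ e11.
exists nu => // Y hY; apply: le_trans (enorm_triangle _ (X + a *: nu) _) _.
have -> : X + a *: nu - E = (a - enorm (E - X)) *: nu.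
  by rewrite scalerBl -EX opprB addrCA addrA.
rewrite enormZ nu1 mulr1 enormBC in XE *.
have : `|a - enorm (E - X)| <= rho - a + e.
  by rewrite ler_norml; have := enorm_ge0 (E - X); lra.
lra.
Qed.

(** The unit sphere is compact: a cluster point of the directions found for
    smaller and smaller [e] serves for all points of the open ball. *)
Lemma touching_ball_limit X (a : R) (Q : set 'rV[R]_m) : 0 < a ->
  (forall e, 0 < e -> exists2 nu : 'rV[R]_m, enorm nu = 1 & forall Y,
    enorm (Y - (X + a *: nu)) <= a - e -> Q Y) ->
  exists2 nu : 'rV[R]_m, enorm nu = 1 & forall Y,
    enorm (Y - (X + a *: nu)) < a -> Q Y.
Proof.
move=> a0 h.
have /choice[f hf] : forall e : R, exists nu : 'rV[R]_m, 0 < e ->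
    enorm nu = 1 /\ forall Y, enorm (Y - (X + a *: nu)) <= a - e -> Q Y.
  move=> e; have [e0|e0] := ltP 0 e; last by exists 0.
  by have [nu nu1 hnu] := h e e0; exists nu.
have Ff : ProperFilter (f @ (0 : R)^'+) by exact: fmap_proper_filter.
have Ball : (f @ (0 : R)^'+) [set u | enorm (u - 0) <= 1].
  have : \forall e \near (0 : R)^'+, enorm (f e - 0) <= 1; last by [].
  near=> e; have e0 : 0 < e by near: e; exact: nbhs_right_gt.
  by have [fe1 _] := hf e e0; rewrite subr0 fe1.
have [nu [_ clnu]] := compact_eball (0 : 'rV[R]_m) 1 _ Ff Ball.
have approx d s : 0 < d -> 0 < s ->
    exists e, [/\ 0 < e, e < s & enorm (nu - f e) <= d].
  move=> d0 s0; have As : (f @ (0 : R)^'+) [set f e | e in [set e | 0 < e < s]].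
    have : \forall e \near (0 : R)^'+, exists2 e' : R, 0 < e' < s & f e' = f e; last by [].
    near=> e; exists e => //; apply/andP; split; near: e.
      exact: nbhs_right_gt.
    exact: nbhs_right_lt.
  have [_ [[e /= /andP[e0 es] <-] ed]] := clnu _ _ As (nbhs_enorm nu d d0).
  by exists e.
exists nu.
  apply/eqP; rewrite eq_le; apply/andP; split; apply/ler_addgt0Pr => d d0;
    have [e [e0 _ ed]] := approx d 1 d0 ltr01; have [fe1 _] := hf e e0.
    by have := enormD (nu - f e) (f e); rewrite subrK fe1; lra.
  by have := enormB nu (nu - f e); rewrite opprB addrCA subrr addr0 fe1; lra.
move=> Y hY; set L := enorm _ in hY.
have s0 : 0 < (a - L) / 2 by lra.
have d0 : 0 < (a - L) / 2 / a by rewrite divr_gt0.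
have [e [e0 es]] := approx _ _ d0 s0; rewrite ler_pdivlMr // => ed.
have [_ he] := hf e e0; apply: he.
have -> : Y - (X + a *: f e) = (Y - (X + a *: nu)) + a *: (nu - f e).
  by apply/rowP => i; rewrite !mxE; ring.
apply: le_trans (enormD _ _) _; rewrite -/L enormZ gtr0_norm //; lra.
Unshelve. all: by end_near. Qed.

End TouchingBalls.


(** * Support functions of the velocity sets *)

Section Hamiltonian.
Context {R : realType} {n : nat}.
Implicit Types (F : 'rV[R]_n -> set 'rV[R]_n) (x y p u v : 'rV[R]_n).

(** The difference quotients from the right are at least the slope of the
    supporting affine function, those from the left at most. *)
Lemma derive_support (V : normedModType R) (f : V -> R) (a v : V) (c : R) :
  derivable f a v -> (forall h, f a + c * h <= f (h *: v + a)) ->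
  'D_v f a = c.
Proof.
move=> df hf; apply/eqP; rewrite eq_le; apply/andP; split.
  apply: (@cvgr_to_le _ _ _ _ _ _ _ (cvg_dnbhs_at_left df)).
  near=> h; have h0 : h < 0 by near: h; exact: nbhs_left_lt.
  by rewrite /= -[_ *: _]mulrC /= ler_ndivrMr // lerBrDl; exact: hf.
apply: (@cvgr_to_ge _ _ _ _ _ _ _ (cvg_dnbhs_at_right df)).
near=> h; have h0 : 0 < h by near: h; exact: nbhs_right_gt.
by rewrite /= -[_ *: _]mulrC /= ler_pdivlMr // lerBrDl; exact: hf.
Unshelve. all: by end_near. Qed.

Definition maximizer F x p : 'rV[R]_n :=
  xget 0 [set v | F x v /\ forall u, F x u -> dotv u p <= dotv v p].

Section maximizer.
Variables (F : 'rV[R]_n -> set 'rV[R]_n) (hF1 : F1 F).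

Lemma maximizerP x p : F x (maximizer F x p) /\
  forall u, F x u -> dotv u p <= dotv (maximizer F x p) p.
Proof.
rewrite /maximizer; case: xgetP => [v _ []//|none].
have [F0 _ Fc] := hF1 x.
have cp : continuous (fun u => dotv u p).
  have -> : (fun u => dotv u p) = dotv p by apply/funext => u; rewrite dotvC.
  exact: dotv_continuous.
have [c + hc] := EVT_max_rV F0 Fc (continuous_subspaceT cp).
rewrite inE => Fxc; case: (none c); split=> // u Fu.
by apply: hc; rewrite inE.
Qed.

Lemma hamiltonianE x p : hamiltonian F x p = dotv (maximizer F x p) p.
Proof.
have [Fm hm] := maximizerP x p; apply/eqP; rewrite eq_le; apply/andP; split.
  apply: ge_sup; first by exists (dotv (maximizer F x p) p), (maximizer F x p).
  by move=> _ [u Fu <-]; exact: hm.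
apply: ub_le_sup; last by exists (maximizer F x p).
by exists (dotv (maximizer F x p) p) => _ [u Fu <-]; exact: hm.
Qed.

Lemma dotv_le_hamiltonian x p u : F x u -> dotv u p <= hamiltonian F x p.
Proof. by rewrite hamiltonianE; apply: (maximizerP x p).2. Qed.

(** Envelope theorem: the linear form of a maximizer touches the support
    function from below. *)
Lemma grad_hamiltonian x p : differentiable (hamiltonian F x) p ->
  grad (hamiltonian F x) p = maximizer F x p.
Proof.
move=> dH; apply/rowP => i; rewrite mxE.
apply: derive_support => [|h]; first exact: diff_derivable.
have -> : maximizer F x p ord0 i * h = dotv (maximizer F x p) (h *: delta_mx ord0 i).
  rewrite dotvZr mulrC; congr (_ * _).
  rewrite /dotv (bigD1 i) //= mxE !eqxx mulr1 big1 ?addr0 // => j ji.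
  by rewrite mxE (negbTE ji) andbF mulr0.
rewrite (hamiltonianE x p) -dotvDr addrC.
by apply: dotv_le_hamiltonian; exact: (maximizerP x p).1.
Qed.

Lemma maximizer_lipschitz : H2 F -> exists2 K : R, 0 <= K &
  forall x y p, p != 0 ->
    enorm (maximizer F x p - maximizer F y p) <= K * enorm (y - x).
Proof.
move=> [dH [K K0 hK]]; exists K => // x y p p0.
by rewrite -!grad_hamiltonian; [exact: hK|exact: dH|exact: dH].
Qed.

(** The realizing ball is contained in [F x], and [F x] lies in the half-space
    where [maximizer F x p] is extremal, so the ball is centred on the inner
    side of the normal direction. *)
Lemma inner_ball_maximizer (r : R) : (forall x, inner_ball_property (F x) r) ->
  forall x p u, enorm p = 1 -> enorm (u - (maximizer F x p - r *: p)) <= r ->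
  F x u.
Proof.
move=> hball x p u p1; set m := maximizer F x p.
have [Fm hm] := maximizerP x p; have [Fcl Ffr] := hball x.
have pp : dotv p p = 1 by rewrite -enorm_sqr p1 expr1n.
have frm : frontier (F x) m.
  split; first exact: subset_closure.
  move=> /nbhs_enormP[d d0 hd].
  have he : F x (m + (d / 2) *: p).
    apply: hd; rewrite opprD addrA subrr sub0r enormN enormZ p1 mulr1.
    by rewrite ger0_norm; lra.
  by have := hm _ he; rewrite dotvDl dotvZl pp; lra.
have [nu [nu0 _ [r0 hnu]]] := Ffr _ frm.
have nu1 : 0 < enorm nu by rewrite enorm_gt0.
pose w := (enorm nu)^-1 *: nu.
have w1 : enorm w = 1.
  by rewrite enormZ ger0_norm ?invr_ge0 ?enorm_ge0 // mulVf // lt0r_neq0.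
have nuw : nu = enorm nu *: w by rewrite scalerA divff ?scale1r ?lt0r_neq0.
clearbody w; have ww : dotv w w = 1 by rewrite -enorm_sqr w1 expr1n.
have openball y : enorm (y - (m + r *: w)) < r -> F x y.
  move=> hy; apply: contrapT => nFy.
  have /hnu : closure (~` F x) y by exact: subset_closure.
  rewrite {1}nuw dotvZl -mulrA ler_pM2l //.
  rewrite ler_pdivlMl ?mulr_gt0 // enorm_sqr => h.
  have : dotv (y - (m + r *: w)) (y - (m + r *: w)) < r ^+ 2.
    rewrite -enorm_sqr ltr_pXn2r // nnegrE ?enorm_ge0 //; exact: ltW.
  have -> : y - (m + r *: w) = (y - m) - r *: w by rewrite opprD addrA.
  by move: h; set z := y - m; clearbody z; rewrite !dotvE (dotvC z w) ww; lra.
have ball y : enorm (y - (m + r *: w)) <= r -> F x y.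
  move=> hy; apply: closed_enorm => // d d0.
  pose z := y - (m + r *: w); pose e := Num.min (1 / 2) (d / (2 * r)).
  have e0 : 0 < e by rewrite lt_min !divr_gt0 // mulr_gt0.
  have e1 : e <= 1 / 2 by rewrite ge_min lexx.
  have er : e * r <= d / 2.
    have : e <= d / (2 * r) by rewrite ge_min lexx orbT.
    by rewrite ler_pdivlMr ?mulr_gt0 //; lra.
  have z0 := enorm_ge0 z.
  exists ((1 - e) *: z + (m + r *: w)).
    by apply: openball; rewrite addrK enormZ ger0_norm; [rewrite -/z in hy; nra|lra].
  have -> : y - ((1 - e) *: z + (m + r *: w)) = e *: z.
    by rewrite scalerBl scale1r opprD addrA addrAC -/z opprB addrCA subrr addr0.
  rewrite enormZ ger0_norm; last exact: ltW.
  rewrite -/z in hy; nra.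
(* the point of the ball furthest in direction [p] is in [F x], hence [w = - p] *)
have wp : dotv w p <= -1.
  have /hm : F x (m + r *: w + r *: p).
    by apply: ball; rewrite addrC addKr enormZ p1 mulr1 ger0_norm // ltW.
  rewrite !dotvE pp => h.
  have : r * (dotv w p + 1) <= 0 by lra.
  by rewrite pmulr_rle0 //; lra.
have -> : p = - w.
  apply/eqP; rewrite -addr_eq0; apply/eqP/dotvv_eq0/eqP.
  by rewrite eq_le dotvv_ge0 andbT !dotvE pp ww (dotvC p w); lra.
by rewrite scalerN opprK; exact: ball.
Qed.

End maximizer.
End Hamiltonian.

(** * Increments of absolutely continuous curves *)

Section AbsoluteContinuity.
Context {R : realType} {n : nat}.
Implicit Types (y : R -> 'rV[R]_n) (p u : 'rV[R]_n) (a b c s t : R).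

(** The supremum of the points where [P] holds satisfies [P] as well, and [P]
    would extend beyond it if it were smaller than [b]. *)
Lemma real_induction (P : R -> Prop) a b : a <= b -> P a ->
  (forall t, a <= t <= b -> exists2 d : R, 0 < d & forall s, a <= s <= b ->
     `|s - t| < d -> (s <= t -> P s -> P t) /\ (t <= s -> P t -> P s)) ->
  P b.
Proof.
move=> ab Pa loc; pose A := [set t | a <= t <= b /\ P t].
have Aa : A a by split=> //; rewrite lexx ab.
have supA : has_sup A.
  by split; [exists a|exists b => t [/andP[]]].
pose t := sup A.
have tab : a <= t <= b.
  apply/andP; split; first exact: sup_upper_bound.
  by apply: ge_sup; [exists a|move=> s [/andP[]]].
have [d d0 hd] := loc _ tab.
have [s [sab Ps] hs] := sup_adherent d0 supA.
have st : s <= t by apply: sup_upper_bound.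
have Pt : P t.
  have [|+ _] := hd _ sab; last exact.
  by rewrite distrC ger0_norm ?subr_ge0 //; rewrite /t; lra.
have [tb|bt] := ltP t b; last first.
  by have -> : b = t by apply/eqP; rewrite eq_le bt; case/andP: tab.
pose e := Num.min (d / 2) (b - t).
have e0 : 0 < e by rewrite lt_min subr_gt0 tb divr_gt0.
have ed : e <= d / 2 by rewrite ge_min lexx.
have eb : e <= b - t by rewrite ge_min lexx orbT.
have teab : a <= t + e <= b by case/andP: tab => *; lra.
have Ate : A (t + e).
  split=> //; have [|_ ] := hd _ teab; last by apply=> //; lra.
  by rewrite addrC addKr ger0_norm; lra.
have := sup_upper_bound supA Ate; rewrite -/t; lra.
Qed.

(** The difference quotient is eventually on the right side of any value beyond
    the derivative, on both sides of the point. *)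
Lemma derivable_drift y t p c : derivable y t 1 -> dotv p ('D_1 y t) < c ->
  exists2 d : R, 0 < d & forall s, `|s - t| < d ->
    (s <= t -> dotv p (y t - y s) <= c * (t - s)) /\
    (t <= s -> dotv p (y s - y t) <= c * (s - t)).
Proof.
move=> dy hc.
have : (fun h => dotv p (h^-1 *: (y (h *: 1 + t) - y t))) @ 0^' --> dotv p ('D_1 y t).
  apply: (@cvg_comp _ _ _ (fun h => h^-1 *: (y (h *: 1 + t) - y t)) (dotv p) _
    (nbhs ('D_1 y t))); [exact: dy|exact: dotv_continuous].
move=> /cvgrPdist_lt /(_ (c - dotv p ('D_1 y t))).
rewrite subr_gt0 => /(_ hc) [d /= d0 hd]; exists d => // s sd.
have key : s != t -> (s - t)^-1 * dotv p (y s - y t) <= c.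
  move=> st; have := hd (s - t).
  rewrite /= sub0r normrN subr_eq0 => /(_ sd st).
  rewrite [_ *: 1]mulr1 subrK dotvZr ltr_norml => /andP[+ _]; lra.
split=> st; (have [->|nst] := eqVneq s t; first by rewrite !subrr dotv0r mulr0).
- have lt : s < t by rewrite lt_def eq_sym nst.
  have := key nst; rewrite mulrC ler_ndivrMr ?subr_lt0 //.
  by rewrite -(opprB (y s)) dotvNr; lra.
- have lt : t < s by rewrite lt_def nst.
  by have := key nst; rewrite mulrC ler_pdivrMr ?subr_gt0.
Qed.

(** Off a null set, the bound on the derivative controls the increments locally.
    The null set is covered by an open set of small measure, on which absolute
    continuity makes the increments small.  Real induction glues the two kinds
    of increments, keeping the record of the intervals of the second kind. *)
Lemma ac_drift y a b p c : a <= b -> absolutely_continuous y a b ->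
  {ae (@lebesgue_measure R), forall t, a <= t <= b ->
     derivable y t 1 /\ dotv p ('D_1 y t) <= c} ->
  dotv p (y b - y a) <= c * (b - a).
Proof.
move=> ab yac [Z [mZ Z0 hZ]].
have {}Z0 : lebesgue_measure Z = 0%E := Z0.
suff H e : 0 < e <= 1 -> dotv p (y b - y a) <=
    (c + e) * (b - a) + enorm p * e + `|c + e| * e.
  apply/ler_addgt0Pr => e0 e0_gt0.
  have k0 : 0 < b - a + enorm p + `|c| + 1.
    by have := enorm_ge0 p; have := normr_ge0 c; lra.
  pose e := Num.min 1 (e0 / (b - a + enorm p + `|c| + 1)).
  have e_gt0 : 0 < e by rewrite lt_min ltr01 divr_gt0.
  have e_le1 : e <= 1 by rewrite ge_min lexx.
  have : e <= e0 / (b - a + enorm p + `|c| + 1) by rewrite ge_min lexx orbT.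
  rewrite ler_pdivlMr // => he.
  have := H e; rewrite e_gt0 => /(_ e_le1).
  have : `|c + e| <= `|c| + 1.
    by apply: le_trans (ler_normD _ _) _; rewrite lerD2l gtr0_norm.
  nra.
move=> /andP[e0 e1]; have [d' d'0 hd'] := yac _ e0.
pose d := Num.min d' e; have d0 : 0 < d by rewrite lt_min d'0.
have [U [Uo ZU muU]] : exists U : set R, [/\ open U, Z `<=` U &
    (lebesgue_measure U < d%:E)%E].
  have [|U [Uo ZU hU]] := @lebesgue_regularity_outer R Z d mZ _ d0.
    by rewrite [X in (X < _)%E]Z0 ltry.
  exists U; split=> //; apply: le_lt_trans hU.
  have mU : measurable U by exact: measurable_realfun.open_measurable.
  rewrite -{1}(setDUK ZU) (le_trans (measureU2 _ _ _)) //; first exact: measurableD.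
  by rewrite [X in (X + _ <= _)%E](_ : _ = 0%E) ?add0e //; exact: Z0.
have mU : measurable U by exact: measurable_realfun.open_measurable.
pose P t := exists (k : nat) (s v : nat -> R), [/\
  forall i, (i < k)%N -> [/\ a <= s i, s i <= v i & v i <= t],
  forall i j, (i < j < k)%N -> v i <= s j,
  ((\sum_(i < k) (v i - s i))%:E <= lebesgue_measure (U `&` `]-oo, t[))%E &
  dotv p (y t - y a) <= (c + e) * (t - a) +
    enorm p * (\sum_(i < k) enorm (y (v i) - y (s i))) +
    `|c + e| * (\sum_(i < k) (v i - s i))].
have Pdrift s t : s <= t -> dotv p (y t - y s) <= (c + e) * (t - s) -> P s -> P t.
  move=> st hst [k [l [r [h1 h2 h3 h4]]]]; exists k, l, r; split=> //.
  - by move=> i /h1[? ? ?]; split=> //; lra.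
  - apply: (le_trans h3); apply: le_measure; rewrite ?inE //.
    + by apply: measurableI => //; exact: measurable_itv.
    + by apply: measurableI => //; exact: measurable_itv.
    + apply: setIS => w /=; rewrite !in_itv /=; lra.
  - have -> : y t - y a = (y t - y s) + (y s - y a) by rewrite addrA subrK.
    rewrite dotvDr; lra.
have PU s t : a <= s -> s <= t -> `]s, t[ `<=` U -> P s -> P t.
  move=> as_ st stU [k [l [r [h1 h2 h3 h4]]]].
  exists k.+1, (fun i => if i == k then s else l i),
    (fun i => if i == k then t else r i); split=> /=.
  - move=> i; rewrite ltnS leq_eqVlt; have [//|_ /=] := eqVneq i k.
    by move=> /h1[? ? ?]; split=> //; lra.
  - move=> i j /andP[ij]; rewrite ltnS leq_eqVlt.
    have [jk _|_ /= jk] := eqVneq j k.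
      by rewrite jk in ij; rewrite (ltn_eqF ij); case: (h1 _ ij).
    by rewrite (ltn_eqF (ltn_trans ij jk)); apply: h2; rewrite ij.
  - rewrite big_ord_recr /= eqxx.
    under eq_bigr => i _ do rewrite (ltn_eqF (ltn_ord i)).
    rewrite EFinD; have [ste|nst] := eqVneq s t.
      by rewrite ste subrr adde0 -ste.
    have {}nst : s < t by rewrite lt_def eq_sym nst.
    have ms : measurable (U `&` `]-oo, s[) by apply: measurableI => //; exact: measurable_itv.
    have := @lebesgue_measure_itv R `]s, t[; rewrite /= lte_fin nst -EFinD => <-.
    apply: (@le_trans _ _ (lebesgue_measure (U `&` `]-oo, s[) + lebesgue_measure `]s, t[%classic)%E).
      exact: leeD.
    rewrite -measureU //; last first.
      rewrite -subset0 => w /= [[_]]; rewrite !in_itv /= => ws /andP[sw _].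
      by have := lt_trans ws sw; rewrite ltxx.
    apply: le_measure; rewrite ?inE //.
    + by apply: measurableU.
    + by apply: measurableI => //; exact: measurable_itv.
    + move=> w /= [[Uw]|]; rewrite !in_itv /= => hw.
        by split=> //; exact: lt_le_trans st.
      by split; [exact: stU|case/andP: hw].
  - rewrite !big_ord_recr /= eqxx.
    under eq_bigr => i _ do rewrite (ltn_eqF (ltn_ord i)).
    under [X in _ <= _ + _ * (X + _)]eq_bigr => i _ do rewrite (ltn_eqF (ltn_ord i)).
    have -> : y t - y a = (y t - y s) + (y s - y a) by rewrite addrA subrK.
    rewrite dotvDr !mulrDr; have := cauchy_schwarz p (y t - y s).
    have : - (c + e) * (t - s) <= `|c + e| * (t - s).
      by rewrite ler_wpM2r ?subr_ge0 // -normrN ler_norm.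
    lra.
have : P b.
  apply: (@real_induction _ a b) => //.
    exists 0%N, (fun=> 0), (fun=> 0); split.
    - by [].
    - by move=> i j /andP[].
    - by rewrite big_ord0 measure_ge0.
    - by rewrite !big_ord0 !subrr dotv0r !mulr0 !addr0.
  move=> t tab; have [Zt|nZt] := pselect (Z t).
    have [r /= r0 hr] : nbhs t U by apply: open_nbhs_nbhs; split=> //; exact: ZU.
    exists r => // s /andP[as_ _] str; move: str; rewrite ltr_norml => /andP[s1 s2].
    case/andP: tab => at_ _; split=> st; apply: PU => // w; rewrite /= in_itv /= => /andP[w1 w2];
      by apply: hr; rewrite /ball_ /= ltr_norml; lra.
  have [dy hc] : derivable y t 1 /\ dotv p ('D_1 y t) <= c.
    by apply: contrapT => nh; apply: nZt; apply: hZ => /(_ tab).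
  have [|r r0 hr] := @derivable_drift y t p (c + e) dy; first by lra.
  exists r => // s _ /hr[h1 h2]; split=> st; apply: Pdrift => //; [exact: h1|exact: h2].
move=> [k [l [r [h1 h2 h3 h4]]]].
have sd : \sum_(i < k) (r i - l i) < d.
  rewrite -lte_fin; apply: (le_lt_trans h3); apply: le_lt_trans muU.
  by apply: le_measure; rewrite ?inE //; apply: measurableI => //; exact: measurable_itv.
have sy : \sum_(i < k) enorm (y (r i) - y (l i)) < e.
  apply: (hd' k (fun i => l i) (fun i => r i)).
  - by move=> i; apply: h1.
  - move=> i j _ _ [w /=]; rewrite !in_itv /= => -[/andP[li ir] /andP[lj jr]].
    have [ij|ji|/val_inj//] := ltngtP i j.
      have rl : r i <= l j by apply: h2; rewrite ij ltn_ord.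
      by have := lt_trans (lt_le_trans ir rl) lj; rewrite ltxx.
    have rl : r j <= l i by apply: h2; rewrite ji ltn_ord.
    by have := lt_trans (lt_le_trans jr rl) li; rewrite ltxx.
  - by apply: lt_le_trans sd _; rewrite ge_min lexx.
have {}sd : \sum_(i < k) (r i - l i) < e.
  by apply: lt_le_trans sd _; rewrite ge_min lexx orbT.
have : enorm p * (\sum_(i < k) enorm (y (r i) - y (l i))) <= enorm p * e.
  by rewrite ler_wpM2l ?enorm_ge0 // ltW.
have : `|c + e| * (\sum_(i < k) (r i - l i)) <= `|c + e| * e.
  by rewrite ler_wpM2l // ltW.
lra.
Qed.


End AbsoluteContinuity.

(** * Trajectories and minimum time *)

Section Shift.
Context {R : realType}.

Lemma lebesgue_measure_shift (c : R) (A : set R) : measurable A ->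
  pushforward (@lebesgue_measure R)
    ((fun t => t + c) : _ -> measurableTypeR R) A = lebesgue_measure A.
Proof.
move=> mA; apply/esym/lebesgue_measure_unique => //=.
  by apply: measurable_realfun.measurable_funD; [exact: measurable_id|exact: measurable_cst].
move=> _ _ [[a b]] _ <-; rewrite /pushforward.
have -> : (fun t => t + c) @^-1` `]a, b]%classic = `]a - c, b - c]%classic.
  by apply/seteqP; split=> t /=; rewrite !in_itv /= ltrBlDr lerBrDr.
rewrite !lebesgue_measure_itv /= !lte_fin ltrD2r.
by case: ifP => // _; rewrite -!EFinD; congr (_%:E); ring.
Qed.

Lemma negligible_shift (N : set R) (c : R) :
  (@lebesgue_measure R).-negligible N ->
  (@lebesgue_measure R).-negligible [set t | N (t + c)].
Proof.
move=> [Z [mZ Z0 NZ]]; exists [set t | Z (t + c)]; split; last by move=> t /NZ.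
  have mf : measurable_fun setT ((fun t => t + c) : measurableTypeR R -> measurableTypeR R).
    by apply: measurable_realfun.measurable_funD; [exact: measurable_id|exact: measurable_cst].
  by have := mf measurableT Z mZ; rewrite setTI.
by rewrite -[RHS]Z0 -(lebesgue_measure_shift c Z mZ).
Qed.

End Shift.

Section Trajectories.
Context {R : realType} {n : nat}.
Variable F : 'rV[R]_n -> set 'rV[R]_n.
Implicit Types (x u : 'rV[R]_n) (y : R -> 'rV[R]_n) (s t b : R).

Lemma derivable_shift y (c t : R) : derivable y (t + c) 1 ->
  derivable (fun s => y (s + c)) t 1 /\
  'D_1 (fun s => y (s + c)) t = 'D_1 y (t + c).
Proof.
have e : (fun h : R => h^-1 *: (((fun s => y (s + c)) \o shift t) (h *: 1) - y (t + c))) =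
    (fun h => h^-1 *: ((y \o shift (t + c)) (h *: 1) - y (t + c))).
  by apply/funext => h /=; rewrite addrA.
by rewrite /derivable /derive e.
Qed.

Lemma trajectory_shift x y t : 0 <= t -> trajectory F x y ->
  trajectory F (y t) (fun s => y (s + t)).
Proof.
move=> t0 [yac _ yF]; split; last 1 first.
- have := negligible_shift _ t yF.
  apply: negligibleS => s /= ns /= h; apply: ns => s0.
  have [|dy Fy] := h; first by lra.
  by have [? ->] := derivable_shift _ _ _ dy.
- move=> b b0 e e0; have [|d d0 hd] := yac (b + t) _ e e0; first by lra.
  exists d => // k l r lr tr sd; apply: (hd k (fun i => l i + t) (fun i => r i + t)).
  + by move=> i; have [? ? ?] := lr i; split; lra.
  + move=> i j _ _ [w /=]; rewrite !in_itv /= => hw.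
    by apply: tr => //; exists (w - t); rewrite /= !in_itv /=; lra.
  + by under eq_bigr => i _ do rewrite opprD addrACA subrr addr0.
- by rewrite add0r.
Qed.

(** Writing the concatenation as a sum of two stopped motions makes its absolute
    continuity a matter of adding two estimates, without splitting intervals at
    the junction. *)
Definition concat x u (tau : R) y (t : R) : 'rV[R]_n :=
  x + Num.min t tau *: u + (y (Num.max (t - tau) 0) - y 0).

Lemma trajectory_concat x u tau y : 0 <= tau ->
  (forall s, 0 <= s <= tau -> F (x + s *: u) u) ->
  trajectory F (x + tau *: u) y -> trajectory F x (concat x u tau y).
Proof.
move=> tau0 Fu [yac y0 yF]; split.
- move=> b b0 e e0; have e2 : 0 < e / 2 by lra.
  have [d d0 hd] := yac _ b0 _ e2.
  have u1 : 0 < enorm u + 1 by have := enorm_ge0 u; lra.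
  exists (Num.min d (e / 2 / (enorm u + 1))); first by rewrite lt_min d0 divr_gt0.
  move=> k l r lr tr; rewrite lt_min => /andP[sd1 sd2].
  pose phi t := Num.max (t - tau) 0.
  have phiP s t : s <= t -> [/\ 0 <= phi s, phi s <= phi t & phi t - phi s <= t - s].
    by move=> st; rewrite /phi !maxEle; case: (leP (s - tau) 0) => ?; case: (leP (t - tau) 0) => ?; split; lra.
  have Hy : \sum_(i < k) enorm (y (phi (r i)) - y (phi (l i))) < e / 2.
    apply: (hd k (phi \o l) (phi \o r)).
    + move=> i; have [l0 li ri] := lr i; have [? ? ?] := phiP _ _ li; split=> //=.
      by rewrite /phi ge_max b0 andbT; lra.
    + move=> i j _ _ [w /=]; rewrite !in_itv /= => -[/andP[i1 i2] /andP[j1 j2]].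
      have [w0 _ _] := phiP (l i) (l i) (lexx _).
      have wp : 0 < w by exact: le_lt_trans i1.
      apply: tr => //; exists (w + tau); rewrite /= !in_itv /=.
      move: i1 i2 j1 j2; rewrite /phi !gt_max !lt_max => /andP[i1 _] /orP[i2|]; last by lra.
      by move=> /andP[j1 _] /orP[j2|]; lra.
    + apply: le_lt_trans sd1; apply: ler_sum => i _ /=.
      by have [_ /phiP[_ _ ?] _] := lr i.
  have Hu : \sum_(i < k) enorm u * (r i - l i) <= e / 2.
    rewrite -mulr_sumr; move: sd2; rewrite ltr_pdivlMr // => sd2.
    have : 0 <= \sum_(i < k) (r i - l i).
      by apply: sumr_ge0 => i _; have [_ ? _] := lr i; rewrite subr_ge0.
    lra.
  apply: (@le_lt_trans _ _ (\sum_(i < k) (enorm u * (r i - l i) + enorm (y (phi (r i)) - y (phi (l i)))))); last first.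
    by rewrite big_split /=; lra.
  apply: ler_sum => i _; have [_ li _] := lr i.
  have -> : concat x u tau y (r i) - concat x u tau y (l i) =
      (Num.min (r i) tau - Num.min (l i) tau) *: u + (y (phi (r i)) - y (phi (l i))).
    rewrite /concat -!/(phi _); apply/rowP => j; rewrite !mxE; ring.
  apply: le_trans (enormD _ _) _; rewrite lerD2r enormZ mulrC ler_wpM2l ?enorm_ge0 //.
  rewrite ger0_norm !minEle; case: (leP (r i) tau) => ?; case: (leP (l i) tau) => ?; lra.
- rewrite /concat sub0r min_l // max_r ?oppr_le0 //.
  by rewrite scale0r subrr !addr0.
have N1 := negligible_shift _ (- tau) yF.
have N0 (a : R) : (@lebesgue_measure R).-negligible [set a].
  by apply/negligibleP; [exact: measurable_set1|exact: lebesgue_measure_set1].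
have N2 := negligibleU (N0 0) (N0 tau).
apply: negligibleS (negligibleU N1 N2) => t /= nt.
apply: contrapT => /not_orP[h1 /not_orP[t0 ttau]]; apply: nt => t_ge0.
have {}t0 : 0 < t by rewrite lt_def t_ge0 andbT; apply/eqP.
have [ltt|gtt] := ltP t tau.
  have E : \near t, x + t *: u = concat x u tau y t.
    near=> s; have s1 : s < tau by near: s; exact: lt_nbhsl.
    by rewrite /concat min_l ?ltW // max_r ?subr_le0 ?ltW // subrr addr0.
  have D : is_derive t 1 (fun t => x + t *: u) u.
    have q : (fun h : R => h^-1 *: (((fun t => x + t *: u) \o shift t) (h *: 1)
        - (x + t *: u))) @ 0^' --> u.
      apply: cvg_near_cst; near=> h; have h0 : h != 0 by near: h; exact: nbhs_dnbhs_neq.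
      rewrite /= opprD addrACA subrr add0r -scalerBl addrK.
      by rewrite [_ *: 1]mulr1 scalerA mulVf // scale1r.
    by apply: DeriveDef; [apply/cvg_ex; exists u|exact: (cvg_lim _ q)].
  have [dv Dv] := near_eq_is_derive E D; split=> //; rewrite Dv.
  by rewrite -(nbhs_singleton E); apply: Fu; rewrite t_ge0 ltW.
have {}gtt : tau < t by rewrite lt_def gtt andbT; apply/eqP.
have E : \near t, (fun s => y (s + - tau)) t = concat x u tau y t.
  near=> s; have s1 : tau < s by near: s; exact: lt_nbhsr.
  rewrite /concat min_r ?ltW // max_l ?subr_ge0 ?ltW //.
  by rewrite y0 addrCA subrr addr0.
have /= {}h1 := contrapT h1; have [|dy Fy] := h1; first by rewrite subr_ge0 ltW.
have [dv Dv] := derivable_shift _ _ _ dy.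
split; first exact: near_eq_derivable E dv.
by rewrite -(near_eq_derive _ E) Dv -(nbhs_singleton E).
Unshelve. all: by end_near. Qed.

End Trajectories.

Section MinTime.
Context {R : realType} {n : nat}.
Variables (F : 'rV[R]_n -> set 'rV[R]_n) (S : set 'rV[R]_n).
Implicit Types (x u : 'rV[R]_n) (y : R -> 'rV[R]_n) (s t b : R).

Lemma min_time_ltP x b : (min_time F S x < b%:E)%E <->
  exists y t, [/\ trajectory F x y, 0 <= t, t < b & S (y t)].
Proof.
split=> [/ereal_inf_lt[_ [y ty <-]] /ereal_inf_lt[_ [t [t0 Syt] <-]]|].
  by rewrite lte_fin => tb; exists y, t.
move=> [y [t [ty t0 tb Syt]]].
apply: (@le_lt_trans _ _ (transition_time S y)); first by apply: ereal_inf_lbound; exists y.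
apply: (@le_lt_trans _ _ t%:E); last by rewrite lte_fin.
by apply: ereal_inf_lbound; exists t.
Qed.

Lemma min_time_ge0 x : (0 <= min_time F S x)%E.
Proof.
apply: le_ereal_inf_tmp => _ [y _ <-]; apply: le_ereal_inf_tmp => _ [t [t0 _] <-].
by rewrite lee_fin.
Qed.

Lemma min_time_leP x b : (forall e, 0 < e -> (min_time F S x < (b + e)%:E)%E) ->
  (min_time F S x <= b%:E)%E.
Proof.
move=> h; apply/lee_addgt0Pr => e e0; rewrite -EFinD; apply: ltW; exact: h.
Qed.

(** Dynamic programming along a segment run at an admissible constant velocity:
    this is how all competing trajectories are produced. *)
Lemma min_time_segment x u (tau b : R) : 0 <= tau ->
  (forall s, 0 <= s <= tau -> F (x + s *: u) u) ->
  (min_time F S (x + tau *: u) <= b%:E)%E -> (min_time F S x <= (b + tau)%:E)%E.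
Proof.
move=> tau0 Fu Tb; apply: min_time_leP => e e0.
have /min_time_ltP[y [t [ty t0 tb Syt]]] :
    (min_time F S (x + tau *: u) < (b + e)%:E)%E.
  by apply: le_lt_trans Tb _; rewrite lte_fin ltrDl.
apply/min_time_ltP; exists (concat x u tau y), (t + tau); split.
- exact: trajectory_concat.
- by rewrite addr_ge0.
- lra.
- have [_ y0 _] := ty.
  rewrite /concat min_r ?lerDr // addrK max_l // y0 addrCA subrr addr0 //.
Qed.

Lemma min_time_along x y (t s : R) : trajectory F x y -> 0 <= s -> s <= t ->
  S (y t) -> (min_time F S (y s) <= (t - s)%:E)%E.
Proof.
move=> ty s0 st Syt; apply: min_time_leP => e e0; apply/min_time_ltP.
exists (fun w => y (w + s)), (t - s); split; [exact: trajectory_shift ty|lra|lra|].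
by rewrite subrK.
Qed.

End MinTime.

Section TrajectoryBounds.
Context {R : realType} {n : nat}.
Variable F : 'rV[R]_n -> set 'rV[R]_n.
Implicit Types (x p : 'rV[R]_n) (y : R -> 'rV[R]_n) (s t : R).

Lemma trajectory_drift x y p (c s t : R) : trajectory F x y ->
  0 <= s -> s <= t ->
  (forall w u, s <= w <= t -> F (y w) u -> dotv p u <= c) ->
  dotv p (y t - y s) <= c * (t - s).
Proof.
move=> [yac _ yF] s0 st hc; apply: ac_drift => //.
  have t0 : 0 <= t by lra.
  move=> e e0; have [d d0 hd] := yac _ t0 _ e0; exists d => // k l r lr.
  by apply: hd => i; have [? ? ?] := lr i; split; lra.
apply: negligibleS yF => w /= nw h; apply: nw => swt.
have [|dy Fy] := h; first by lra.
by split=> //; exact: hc Fy.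
Qed.

Lemma trajectory_speed x y (M s t : R) : trajectory F x y -> 0 <= M ->
  0 <= s -> s <= t ->
  (forall w u, s <= w <= t -> F (y w) u -> enorm u <= M) ->
  enorm (y t - y s) <= M * (t - s).
Proof.
move=> ty M0 s0 st hM; set D := y t - y s.
have [->|D0] := eqVneq (enorm D) 0; first by rewrite mulr_ge0 // subr_ge0.
have D1 : 0 < enorm D by rewrite lt_def D0 enorm_ge0.
rewrite -(ler_pM2l D1) -expr2 enorm_sqr mulrA.
apply: (trajectory_drift _ _ D _ _ _ ty) => // w u hw Fu.
by apply: le_trans (cauchy_schwarz _ _) _; rewrite ler_pM2l //; exact: hM Fu.
Qed.

(** As long as the trajectory stays in the unit ball its speed is at most [M], so
    that it is in fact well inside the ball, and continuity takes it further. *)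
Lemma trajectory_bound x y (M tau : R) : trajectory F x y ->
  (forall z u, enorm (z - x) <= 1 -> F z u -> enorm u <= M) ->
  0 <= M -> 0 <= tau -> M * tau <= 1 / 2 ->
  forall s, 0 <= s <= tau -> enorm (y s - x) <= M * s.
Proof.
move=> ty hM M0 tau0 Mtau.
have [yac y0 _] := ty.
suff : forall s, 0 <= s <= tau -> enorm (y s - x) <= M * s by [].
apply: (@real_induction _ (fun t => forall s, 0 <= s <= t -> enorm (y s - x) <= M * s) 0) => //.
  move=> s s0; have -> : s = 0 by apply/eqP; rewrite eq_le andbC.
  by rewrite y0 subrr enorm0 mulr0.
have [|d d0 hd] := yac _ tau0 (1 / 2); first by lra.
have small s t : 0 <= s -> s <= t -> t <= tau -> t - s < d -> enorm (y t - y s) <= 1 / 2.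
  move=> s0 st ttau td; have := hd 1%N (fun=> s) (fun=> t).
  rewrite !big_ord1 => h; apply/ltW/h => //.
  by move=> i j _ _ _; exact: etrans (ord1 i) (esym (ord1 j)).
have ext s t : 0 <= s -> s <= t -> t <= tau -> t - s < d ->
    (forall w, 0 <= w <= s -> enorm (y w - x) <= M * w) ->
    forall w, 0 <= w <= t -> enorm (y w - x) <= M * w.
  move=> s0 st ttau td Ps w /andP[w0 wt].
  have near1 q : 0 <= q <= w -> enorm (y q - x) <= 1.
    move=> /andP[q0 qw]; have [qs|sq] := leP q s.
      have := Ps q; rewrite q0 qs => /(_ isT).
      have : M * q <= M * tau by rewrite ler_wpM2l //; lra.
      lra.
    have := Ps s; rewrite s0 lexx => /(_ isT).
    have : M * s <= M * tau by rewrite ler_wpM2l //; lra.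
    have := small s q s0 (ltW sq) ltac:(lra) ltac:(lra).
    have := enorm_triangle (y q) (y s) x; lra.
  rewrite -{1}y0 -[w in M * w]subr0.
  by apply: (trajectory_speed _ _ _ _ _ ty) => // q u /near1; exact: hM.
move=> t /andP[t0 ttau]; exists d => // s /andP[s0 stau] sd.
by split=> st; apply: ext => //; move: sd; rewrite ltr_norml => /andP[]; lra.
Qed.

End TrajectoryBounds.

(** * One backward step *)

Section VelocityCone.
Context {R : realType} {n : nat}.
Implicit Types (v N a : 'rV[R]_n).

(** Segments may be run at any speed [alpha] close to [1], so the space-time
    velocities available at a point fill the cone of the vectors
    [(alpha u, - alpha)].  At a boundary point [(v, -1)] of this cone the outward
    normal is the tilted vector [(N, <N, v>)], and the cone over the velocity ball
    of centre [v - r N] and radius [r] contains a space-time ball touching there.  The normal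
    is frozen at a value [mh] of [<N, v>]; the tilt error [<N, v> - mh] only costs
    its square, which keeps the estimate compatible with second order contact. *)
Lemma tilted_ball v N a (b mh r M delta lam : R) :
  let rt := r / (4 * (1 + M ^+ 2)) in
  0 < r -> 1 <= M -> r <= M -> enorm N = 1 -> enorm v <= M ->
  0 < lam -> lam ^+ 2 * (1 + mh ^+ 2) = 1 -> 0 <= delta ->
  enorm (graph_pt a b) <= rt - 8 * rt * (dotv v N - mh) ^+ 2 - 8 * delta ->
  let alpha := 1 + rt * lam * mh - b in
  let u := alpha^-1 *: (v - (rt * lam) *: N + a) in
  1 / 2 <= alpha <= 2 /\ enorm (u - (v - r *: N)) <= r - delta.
Proof.
move=> rt r0 M1 rM N1 vM lam0 lamE d0 hA alpha u.
have NN : dotv N N = 1 by rewrite -enorm_sqr N1 expr1n.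
have rtE : 4 * rt * (1 + M ^+ 2) = r.
  by rewrite /rt; field; rewrite lt0r_neq0 // ltr_wpDr ?sqr_ge0.
clearbody rt.
have M2 : M <= M ^+ 2 by rewrite expr2 ler_peMl //; lra.
have rt0 : 0 < rt.
  have : 0 < 4 * rt * (1 + M ^+ 2) by rewrite rtE.
  by rewrite pmulr_lgt0; [lra|have := sqr_ge0 M; lra].
have rt8 : rt <= 1 / 8.
  have h : 4 * rt * (1 + M ^+ 2) <= (1 + M ^+ 2) / 2.
    by rewrite rtE; have := sqr_ge0 (M - 1); rewrite expr2; lra.
  have h1 : 0 < 1 + M ^+ 2 by have := sqr_ge0 M; lra.
  have : 4 * rt <= 1 / 2 by rewrite -(ler_pM2r h1); lra.
  lra.
set Dm := dotv v N - mh in hA.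
have D2 := sqr_ge0 Dm.
have rD2 : 0 <= rt * Dm ^+ 2 by rewrite mulr_ge0 // ltW.
(* the part of the perturbation beyond the contact point of the tilted ball *)
pose a' := a - (rt * lam) *: N; pose b' := b - rt * lam * mh.
have alphaE : alpha = 1 - b' by rewrite /alpha /b'; ring.
pose s := lam * (dotv N a + mh * b); pose g := rt - s.
have nA := enorm_ge0 (graph_pt a b).
have AA : dotv a a + b * b <= rt ^+ 2.
  have -> : dotv a a + b * b = enorm (graph_pt a b) ^+ 2 by rewrite enorm_sqr dotv_graph.
  by rewrite ler_pXn2r ?nnegrE //; lra.
have gE : 8 * rt * Dm ^+ 2 + 8 * delta <= g.
  have : s <= enorm (graph_pt a b).
    have := cauchy_schwarz (graph_pt (lam *: N) (lam * mh)) (graph_pt a b).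
    have -> : enorm (graph_pt (lam *: N) (lam * mh)) = 1.
      rewrite /enorm dotv_graph !dotvE NN.
      rewrite (_ : _ + _ = lam ^+ 2 * (1 + mh ^+ 2)); last by ring.
      by rewrite lamE sqrtr1.
    by rewrite mul1r dotv_graph !dotvE /s; lra.
  rewrite /g; lra.
have g0 : 0 <= g by lra.
have ab' : dotv a' a' + b' ^+ 2 <= 2 * rt * g.
  have -> : dotv a' a' + b' ^+ 2 = (dotv a a + b * b) - 2 * rt * s
      + rt ^+ 2 * (lam ^+ 2 * (1 + mh ^+ 2)).
    rewrite /a' /b' /s !dotvE NN (dotvC a N); ring.
  rewrite lamE /g; rewrite expr2 in AA *; lra.
have a'0 := dotvv_ge0 a'.
have g2 : g <= 2 * rt.
  have h : g ^+ 2 <= dotv a' a' + b' ^+ 2 .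
    have := cauchy_schwarz (graph_pt (lam *: N) (lam * mh)) (graph_pt (- a') (- b')).
    have -> : enorm (graph_pt (lam *: N) (lam * mh)) = 1.
      rewrite /enorm dotv_graph !dotvE NN.
      rewrite (_ : _ + _ = lam ^+ 2 * (1 + mh ^+ 2)); last by ring.
      by rewrite lamE sqrtr1.
    have -> : dotv (graph_pt (lam *: N) (lam * mh)) (graph_pt (- a') (- b')) = g.
      rewrite (_ : g = rt * (lam ^+ 2 * (1 + mh ^+ 2)) - s); last by rewrite lamE mulr1.
      rewrite dotv_graph /s /a' /b' !dotvE NN; ring.
    rewrite mul1r => h; have -> : dotv a' a' + b' ^+ 2 = enorm (graph_pt (- a') (- b')) ^+ 2.
      by rewrite enorm_sqr dotv_graph !dotvE; ring.
    by rewrite ler_pXn2r ?nnegrE ?enorm_ge0.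
  have [->|gn0] := eqVneq g 0; first by lra.
  have gp : 0 < g by rewrite lt_def gn0.
  by rewrite -(ler_pM2r gp); rewrite !expr2 in h ab'; lra.
have b'2 : b' ^+ 2 <= (2 * rt) ^+ 2.
  have : rt * g <= rt * (2 * rt) by rewrite ler_wpM2l // ltW.
  by move: ab'; rewrite !expr2; lra.
have b'b : `|b'| <= 2 * rt.
  by rewrite -(ler_pXn2r (n := 2)) ?nnegrE ?real_normK ?num_real //; lra.
move: b'b; rewrite ler_norml => /andP[b'1 b'3].
have al0 : 1 / 2 <= alpha <= 2 by rewrite alphaE; lra.
split=> //; case/andP: al0 => al1 al2.
have alp : 0 < alpha by lra.
pose D := a' + b' *: v.
have uE : u - (v - r *: N) = alpha^-1 *: (D + (alpha * r) *: N).
  have -> : D + (alpha * r) *: N = (v - (rt * lam) *: N + a) - alpha *: (v - r *: N).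
    rewrite /D alphaE /a'; apply/rowP => j; rewrite !mxE; ring.
  by rewrite scalerBr scalerA mulVf ?lt0r_neq0 // scale1r.
rewrite uE enormZ gtr0_norm ?invr_gt0 // ler_pdivrMl //.
have rd : 0 <= r - delta.
  have : rt <= r by rewrite -rtE; have := sqr_ge0 M; nra.
  lra.
rewrite enorm_le; last by rewrite mulr_ge0 // ltW.
(* radial component: the tilt makes the first-order terms cancel *)
have kap : 1 <= lam^-1.
  rewrite -(ler_pM2l lam0) mulr1 mulfV ?lt0r_neq0 //.
  rewrite -(ler_pXn2r (n := 2)) ?nnegrE ?ler01 ?(ltW lam0) // expr1n.
  by have := sqr_ge0 (lam * mh); rewrite exprMn; lra.
have ND : dotv N D = - (lam^-1 * g) + b' * Dm.
  have lam1 : lam * lam^-1 = 1 by rewrite mulfV // lt0r_neq0.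
  have e1 : lam^-1 * s = dotv N a + mh * b.
    by rewrite /s mulrA mulVf ?lt0r_neq0 // mul1r.
  have e2 : lam^-1 * rt = rt * lam * (1 + mh ^+ 2).
    apply: (mulfI (lt0r_neq0 lam0)); rewrite mulrA lam1 mul1r.
    by rewrite -[LHS]mulr1 -[X in _ * X]lamE; ring.
  rewrite /g mulrBr opprB e1 e2 /D /Dm /a' /b' !dotvE NN (dotvC v N); ring.
clearbody a' b'.
have DD : dotv D D <= r / 2 * g.
  have h1 : dotv D D <= (1 + M ^+ 2) * (dotv a' a' + b' ^+ 2).
    have vM2 : dotv v v <= M ^+ 2 by rewrite -enorm_le //; lra.
    have h2 := dotvv_ge0 (M *: a' - (b' / M) *: v).
    have M0 : M != 0 by rewrite lt0r_neq0 //; lra.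
    have h3 : dotv (M *: a' - (b' / M) *: v) (M *: a' - (b' / M) *: v) =
       M ^+ 2 * dotv a' a' - 2 * b' * dotv a' v + b' ^+ 2 / M ^+ 2 * dotv v v.
      by rewrite !dotvE (dotvC v a'); field.
    have h4 : b' ^+ 2 / M ^+ 2 * dotv v v <= b' ^+ 2.
      rewrite mulrAC ler_pdivrMr ?exprn_gt0 //; last by lra.
      by rewrite ler_wpM2l ?sqr_ge0.
    have h5 : b' ^+ 2 * dotv v v <= b' ^+ 2 * M ^+ 2 by rewrite ler_wpM2l ?sqr_ge0.
    rewrite /D !dotvE (dotvC v a'); rewrite !expr2 in h3 h4 h5 *; lra.
  apply: le_trans h1 _; rewrite -rtE.
  have h6 : (1 + M ^+ 2) * (dotv a' a' + b' ^+ 2) <= (1 + M ^+ 2) * (2 * rt * g).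
    by rewrite ler_wpM2l // addr_ge0 ?sqr_ge0.
  lra.
have bD : 2 * (b' * Dm) <= g / 2 + 4 * rt * Dm ^+ 2.
  have h7 := sqr_ge0 (b' - 4 * rt * Dm).
  rewrite -(ler_pM2l rt0); rewrite !expr2 in h7 ab' *; lra.
have lg : g <= lam^-1 * g by rewrite ler_peMl.
clearbody D; rewrite !dotvE NN (dotvC D N) ND.
have ar : 0 < alpha * r by rewrite mulr_gt0.
have k1 : alpha * r * (- 2 * (lam^-1 * g) + 2 * (b' * Dm)) <=
    alpha * r * (- (3 / 2) * g + 4 * rt * Dm ^+ 2).
  by rewrite ler_pM2l //; lra.
have k2 : r / 2 * g <= alpha * r * g.
  have : r * (1 / 2 * g) <= r * (alpha * g) by rewrite ler_pM2l // ler_wpM2r.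
  lra.
have k3 : alpha * r * (8 * rt * Dm ^+ 2 + 8 * delta) <= alpha * r * g by rewrite ler_pM2l.
have k4 : alpha * (alpha * (r * delta)) <= 2 * (alpha * (r * delta)).
  by rewrite ler_wpM2r // !mulr_ge0 // ltW.
have k5 := sqr_ge0 (alpha * delta).
have k6 : 0 <= alpha * (r * delta) by rewrite !mulr_ge0 // ltW.
rewrite !expr2 in k1 k2 k3 k4 k5 k6 *; lra.
Qed.

End VelocityCone.

(** Below, [V x N] is the velocity of [F x] furthest in the unit direction [N] and
    [ham x N] is the value [H(x, N)] it attains.  The hypotheses on [F] enter only
    through the inner balls at [V x N], the Lipschitz dependence of [V] on [x], a
    bound on [F] near [x0], and the approximate quadratic support of [ham] that
    semiconvexity provides. *)
Section BackwardStep.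
Context {R : realType} {n : nat}.
Variables (F : 'rV[R]_n -> set 'rV[R]_n) (S : set 'rV[R]_n).
Variables (K r M : R) (x0 : 'rV[R]_n).
Implicit Types (x y u N : 'rV[R]_n) (E P : 'rV[R]_(n + 1)).

Let V x N := maximizer F x N.
Let ham x N := dotv (V x N) N.

Hypothesis K1 : 1 <= K.
Hypothesis M1 : 1 <= M.
Hypothesis r_gt0 : 0 < r.
Hypothesis rM : r <= M.
Hypothesis V_ball : forall x N u, enorm N = 1 ->
  enorm (u - (V x N - r *: N)) <= r -> F x u.
Hypothesis V_lip : forall x y N, enorm N = 1 ->
  enorm (V x N - V y N) <= K * enorm (x - y).
Hypothesis F_bound : forall x u, enorm (x - x0) <= 2 -> F x u -> enorm u <= M.
Hypothesis ham_support : forall x N (eta : R), enorm N = 1 -> 0 < eta <= 1 ->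
  exists2 zeta, enorm zeta <= 3 * K & forall y,
    ham x N + dotv zeta (y - x) - K * enorm (y - x) ^+ 2 - eta <= ham y N.

Definition epi_ball E (rho : R) := forall y b,
  enorm (graph_pt y b - E) <= rho -> (min_time F S y <= b%:E)%E.

(** Radius of the space-time ball of velocities given by [tilted_ball], hence the
    rate at which the radius of the propagated balls grows. *)
Definition growth : R := r / (4 * (1 + M ^+ 2)).

Lemma growth_gt0 : 0 < growth.
Proof. by rewrite divr_gt0 // mulr_gt0 // ltr_wpDr ?sqr_ge0. Qed.

Lemma growth_le : growth <= 1 / 8.
Proof.
have h1 : 0 < 1 + M ^+ 2 by rewrite ltr_wpDr ?sqr_ge0.
rewrite /growth ler_pdivrMr ?mulr_gt0 //.
by have := sqr_ge0 (M - 1); have := rM; rewrite !expr2; lra.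
Qed.

Lemma V_bound x N : enorm N = 1 -> enorm (x - x0) <= 2 -> enorm (V x N) <= M.
Proof.
move=> N1 /F_bound; apply; apply: (V_ball _ N) => //.
by rewrite opprB addrCA subrr addr0 enormZ N1 mulr1 gtr0_norm.
Qed.

(** Centre of the space-time ball of velocities at [y], for the frozen unit normal
    [(lam N, lam mh)]. *)
Definition velocity_center y N (mh lam : R) : 'rV[R]_(n + 1) :=
  graph_pt (V y N) (-1) - growth *: graph_pt (lam *: N) (lam * mh).

(** A velocity deep enough in [F y] stays admissible along a short segment.  Hence
    the space-time velocities of the tilted ball, slightly reduced, are realized by
    straight segments, to which [min_time_segment] applies. *)
Lemma back_segment y b E (rho h mh lam : R) N :
  enorm N = 1 -> enorm (y - x0) <= 2 -> 0 < h -> 0 <= rho ->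
  0 < lam -> lam ^+ 2 * (1 + mh ^+ 2) = 1 ->
  0 <= growth - 8 * growth * (ham y N - mh) ^+ 2 - 16 * K * M * h ->
  enorm (graph_pt y b + h *: velocity_center y N mh lam - E) <=
    rho + h * (growth - 8 * growth * (ham y N - mh) ^+ 2 - 16 * K * M * h) ->
  epi_ball E rho -> (min_time F S y <= b%:E)%E.
Proof.
have := K1; have := M1 => M1' K1'.
move=> N1 yx0 h0 rho0 lam0 lamE; set s := growth - _ - _ => s0 hs hE.
have hs0 : 0 <= h * s by rewrite mulr_ge0 // ltW.
have [Q Qs QE] := ball_sum _ _ _ rho0 hs0 hs.
have [a [c QE']] := graph_pt_surj (h^-1 *: Q).
have Qh : Q = h *: graph_pt a c.
  by rewrite -QE' scalerA mulfV ?lt0r_neq0 // scale1r.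
have ac : enorm (graph_pt a c) <= s.
  by rewrite -QE' enormZ gtr0_norm ?invr_gt0 // ler_pdivrMl.
have vM := V_bound _ _ N1 yx0.
have d0 : 0 <= 2 * K * M * h by rewrite !mulr_ge0 //; lra.
have hac : enorm (graph_pt a c) <=
    growth - 8 * growth * (dotv (V y N) N - mh) ^+ 2 - 8 * (2 * K * M * h).
  by move: ac; rewrite /s /ham; lra.
have [] := tilted_ball _ _ _ _ _ _ _ _ _ r_gt0 M1 rM N1 vM lam0 lamE d0 hac.
rewrite -/growth; set alpha := 1 + _ - c; set u := _ *: _ => /andP[al1 al2] uball.
have al0 : 0 < alpha by lra.
have Fu : F y u by apply: (V_ball _ N) => //; lra.
have uM := F_bound _ _ yx0 Fu.
have E1 : graph_pt y b + h *: velocity_center y N mh lam + Q =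
    graph_pt (y + (h * alpha) *: u) (b - h * alpha).
  rewrite Qh /velocity_center !graph_ptE; congr graph_pt.
    rewrite /u -scalerA [alpha *: _]scalerA mulfV ?lt0r_neq0 // scale1r.
    by apply/rowP => i; rewrite !mxE; ring.
  by rewrite /alpha; ring.
have T1 : (min_time F S (y + (h * alpha) *: u) <= (b - h * alpha)%:E)%E.
  by apply: hE; rewrite -E1 addrAC.
have ha0 : 0 <= h * alpha by rewrite mulr_ge0 // ltW.
rewrite -[b](subrK (h * alpha)); apply: (min_time_segment _ _ _ u) => // q /andP[q0 q1].
apply: (V_ball _ N) => //.
have -> : u - (V (y + q *: u) N - r *: N) =
   (u - (V y N - r *: N)) + (V y N - V (y + q *: u) N).
  by apply/rowP => i; rewrite !mxE; ring.
apply: le_trans (enormD _ _) _.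
have h1 := V_lip y (y + q *: u) N N1.
have h2 : enorm (y - (y + q *: u)) <= 2 * h * M.
  rewrite opprD addrA subrr sub0r enormN enormZ ger0_norm //.
  apply: ler_pM; rewrite ?enorm_ge0 //.
  by apply: (le_trans q1); rewrite mulrC ler_wpM2r // ltW.
have h3 : K * enorm (y - (y + q *: u)) <= K * (2 * h * M) by rewrite ler_wpM2l //; lra.
lra.
Qed.

(** Explicit constants, depending on [K], [r] and [M] only, so that the final
    radius is a continuous function of the initial point. *)
Definition offset_const : R := 20 * M * K ^+ 2.
Definition depth_const : R := 8 * offset_const / growth.
Definition push_const : R := depth_const + offset_const * (2 / growth).
Definition slack_const : R := K + (15 * K ^+ 2 + K * push_const) ^+ 2 / 2 + 16 * K * M.
Definition error_const : R := slack_const + 9 * K ^+ 2 * offset_const + K * M + offset_const ^+ 2 / 2.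
Definition max_radius : R := growth / (100 * K ^+ 2).

Lemma offset_const_ge : 2 * M + 5 + 13 * K ^+ 2 <= offset_const.
Proof.
have K1' := K1; have M1' := M1.
have KK : 1 <= K ^+ 2 by rewrite exprn_ege1.
have MK : M <= M * K ^+ 2 by rewrite ler_peMr //; lra.
have MK1 : K ^+ 2 <= M * K ^+ 2 by rewrite ler_peMl //; lra.
rewrite /offset_const; lra.
Qed.

Lemma max_radiusE : 100 * K ^+ 2 * max_radius = growth.
Proof.
have K1' := K1; rewrite /max_radius mulrC divfK // lt0r_neq0 // mulr_gt0 // exprn_gt0 //; lra.
Qed.

Lemma max_radius_gt0 : 0 < max_radius.
Proof.
have K1' := K1; rewrite divr_gt0 ?growth_gt0 // mulr_gt0 // exprn_gt0 //; lra.
Qed.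

Lemma max_radius_le : max_radius <= growth / 100.
Proof.
have : 1 * max_radius <= K ^+ 2 * max_radius.
  by rewrite ler_wpM2r ?(ltW max_radius_gt0) // exprn_ege1 // K1.
by have := max_radiusE; lra.
Qed.

Lemma offset_const_ge0 : 0 <= offset_const.
Proof. by have := offset_const_ge; have := sqr_ge0 K; have := M1; lra. Qed.

Lemma depth_const_ge0 : 0 <= depth_const.
Proof. by rewrite divr_ge0 ?(ltW growth_gt0) // mulr_ge0 // offset_const_ge0. Qed.

Lemma push_const_ge0 : 0 <= push_const.
Proof.
by rewrite /push_const addr_ge0 ?depth_const_ge0 // mulr_ge0 ?offset_const_ge0 // divr_ge0 // ltW // growth_gt0.
Qed.

Lemma slack_const_ge : 16 * K * M <= slack_const.
Proof.
by rewrite /slack_const; have := sqr_ge0 (15 * K ^+ 2 + K * push_const); have := K1; lra.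
Qed.

Lemma slack_const_ge0 : 0 <= slack_const.
Proof.
apply: le_trans slack_const_ge; rewrite !mulr_ge0 //; [have := K1|have := M1]; lra.
Qed.

(** One backward step of length [h], from the trajectory point [xk] at level [b] to
    [xh] at level [b + h].  The old ball has centre [E] and radius [rho]; [P] is
    the unit direction from [E] to the old point and [N] the direction of its
    space component, reversed.  The new centre [E'] retraces the centre [Co] of the
    velocity ball and adds the correction [G] of [ball_push].  The equation [rho'E]
    for the new radius [rho'] is the balance between the growth rate and the
    losses. *)
Section OneStep.
Variables (xk xh zeta N p : 'rV[R]_n) (b h rho rho' q lam : R).
Variable E : 'rV[R]_(n + 1).

Let P := graph_pt p q.
Let l := enorm (graph_pt xk b - E).
Let d := `|rho - l|.
Let j := d + offset_const * h.
Let mh := ham xh N.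
Let zt := graph_pt zeta (0 : R).
Let theta := enorm p * dotv zt P + 10 * K ^+ 2.
Let G := - (rho' * enorm p) *: zt - (10 * K ^+ 2 * rho') *: P.
Let Co := velocity_center xh N mh lam.
Let E' := E - h *: Co - h *: G.
Let X' := graph_pt xh (b + h).
Let Dl := graph_pt (xk - xh) (- h).

Hypothesis xh_x0 : enorm (xh - x0) <= 1.
Hypothesis h0 : 0 < h.
Hypothesis c1h : offset_const * h <= max_radius.
Hypothesis cBh : slack_const * h <= growth / 8.
Hypothesis rho_ge0 : 0 <= rho.
Hypothesis rho_le : rho + h * growth <= max_radius.
Hypothesis d_le : d <= depth_const * rho.
Hypothesis d_small : d <= max_radius.
Hypothesis xk_xh : enorm (xk - xh) <= M * h.
Hypothesis drift : dotv N (xk - xh) <= h * (mh + K * M * h).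
Hypothesis P1 : enorm P = 1.
Hypothesis XE : graph_pt xk b - E = l *: P.
Hypothesis pE : - p = enorm p *: N.
Hypothesis N1 : enorm N = 1.
Hypothesis lam0 : 0 < lam.
Hypothesis lamE : lam ^+ 2 * (1 + mh ^+ 2) = 1.
Hypothesis zeta3 : enorm zeta <= 3 * K.
Hypothesis zetaP : forall y,
  mh + dotv zeta (y - xh) - K * enorm (y - xh) ^+ 2 - h <= ham y N.
Hypothesis rho'E :
  rho' + h * (rho' * theta) = rho + h * (growth - 9 * K ^+ 2 * j - slack_const * h).

Lemma P_sqr : dotv P P = 1. Proof. by rewrite -enorm_sqr P1 expr1n. Qed.

Lemma p_le1 : enorm p <= 1. Proof. by rewrite -P1; exact: enorm_graphl. Qed.

Lemma dotv_p u : dotv p u = - (enorm p * dotv N u).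
Proof. by rewrite -{1}(opprK p) pE dotvNl dotvZl. Qed.

Lemma d_ge0 : 0 <= d. Proof. exact: normr_ge0. Qed.

Lemma c1h_ge : h <= offset_const * h.
Proof.
rewrite ler_peMl ?(ltW h0) //.
by have := offset_const_ge; have := M1; have := sqr_ge0 K; lra.
Qed.

Lemma j_ge0 : 0 <= j.
Proof. by rewrite /j; have := d_ge0; have := c1h_ge; have := h0; lra. Qed.

Lemma theta_bounds : 0 <= theta <= 13 * K ^+ 2.
Proof.
have zt3 : enorm zt <= 3 * K by rewrite enorm_graph0.
have K1' := K1; have KK : K <= K ^+ 2 by rewrite expr2 ler_peMl //; lra.
have : `|enorm p * dotv zt P| <= 1 * (3 * K).
  rewrite normrM (ger0_norm (enorm_ge0 p)).
  apply: ler_pM; rewrite ?enorm_ge0 ?p_le1 // ler_norml.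
  by have := cauchy_schwarz zt P; have := cauchy_schwarzN zt P; rewrite P1; lra.
by rewrite ler_norml /theta => /andP[]; lra.
Qed.

Lemma radius_bounds :
  [/\ 0 <= rho', rho + h * growth / 2 <= rho' & rho' <= rho + h * growth].
Proof.
have /andP[t0 t1] := theta_bounds; have h0' := ltW h0; have rt0 := growth_gt0.
have hth : 0 < 1 + h * theta by rewrite ltr_wpDr // mulr_ge0.
have rm := max_radiusE; have rho0 := rho_ge0; have rhol := rho_le.
have hrt : 0 <= h * growth by rewrite mulr_ge0 // ltW.
have Kj : 9 * K ^+ 2 * j <= 18 / 100 * growth.
  have : K ^+ 2 * j <= K ^+ 2 * (2 * max_radius).
    by rewrite ler_wpM2l ?sqr_ge0 // /j; have := d_small; have := c1h; lra.
  lra.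
have E1 := rho'E; have hB := cBh.
have r0 : 0 <= rho'.
  rewrite -(pmulr_lge0 _ hth) (_ : rho' * _ = rho' + h * (rho' * theta)); last by ring.
  rewrite E1; apply: addr_ge0 => //; apply: mulr_ge0 => //.
  by lra.
have a1 : 0 <= h * (rho' * theta) by rewrite !mulr_ge0.
have a2 : 0 <= h * (9 * K ^+ 2 * j) by rewrite mulr_ge0 // mulr_ge0 ?j_ge0 // mulr_ge0 ?sqr_ge0.
have a3 : 0 <= h * (slack_const * h) by rewrite !mulr_ge0 // slack_const_ge0.
have rl : rho' <= rho + h * growth by lra.
have a4 : rho' * theta <= max_radius * (13 * K ^+ 2).
  by apply: ler_pM => //; lra.
have a5 : h * (rho' * theta + 9 * K ^+ 2 * j + slack_const * h) <= h * (growth / 2).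
  by rewrite ler_wpM2l //; lra.
by split=> //; lra.
Qed.

Lemma rho'_small : rho' <= max_radius.
Proof. by have [_ _] := radius_bounds; have := rho_le; lra. Qed.

Lemma max_radius_le1 : max_radius <= 1.
Proof. by have := max_radius_le; have := growth_le; lra. Qed.

Lemma G_bound : enorm G <= 13 * K ^+ 2.
Proof.
have [r0 _ _] := radius_bounds; have K1' := K1.
have rs := rho'_small; have rm := max_radius_le1.
have KK : K <= K ^+ 2 by rewrite expr2 ler_peMl //; lra.
apply: le_trans (enormB _ _) _; rewrite !enormZ normrN P1 mulr1.
rewrite (ger0_norm (mulr_ge0 r0 (enorm_ge0 p))) ger0_norm; last first.
  by rewrite mulr_ge0 // mulr_ge0 ?sqr_ge0.
have a1 : rho' * enorm p * enorm zt <= 1 * (3 * K).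
  apply: ler_pM; rewrite ?mulr_ge0 ?enorm_ge0 // ?enorm_graph0 //.
  by rewrite -[1]mulr1; apply: ler_pM; rewrite ?enorm_ge0 ?p_le1 //; lra.
have a2 : K ^+ 2 * rho' <= K ^+ 2 * 1 by rewrite ler_wpM2l ?sqr_ge0 //; lra.
by lra.
Qed.

Lemma normal_unit : enorm (graph_pt (lam *: N) (lam * mh)) = 1.
Proof.
have NN : dotv N N = 1 by rewrite -enorm_sqr N1 expr1n.
rewrite /enorm dotv_graph dotvZl dotvZr NN -[RHS]sqrtr1; congr Num.sqrt.
by rewrite -[RHS]lamE; ring.
Qed.

Lemma velocity_center_bound : enorm Co <= M + 1 + growth.
Proof.
apply: le_trans (enormB _ _) _.
rewrite enormZ normal_unit mulr1 gtr0_norm ?growth_gt0 // lerD2r.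
apply: le_trans (enorm_graph_le _ _) _; rewrite normrN1 lerD2r V_bound //.
by have := xh_x0; lra.
Qed.

Lemma displacement_bound : enorm Dl <= h * (M + 1).
Proof.
apply: le_trans (enorm_graph_le _ _) _; rewrite normrN gtr0_norm //.
by have := xk_xh; lra.
Qed.

Lemma new_pointE : X' = E + l *: P - Dl.
Proof.
rewrite -XE [E + _]addrC subrK /X' /Dl !graph_ptE; congr graph_pt.
  by rewrite opprB addrC subrK.
by rewrite opprK.
Qed.

(** The contact point of the new ball stays close to the new trajectory point,
    up to the depth [d] of the trajectory inside the ball. *)
Lemma contact_shift : enorm (rho' *: P + E' - X') <= j.
Proof.
have [_ _ rl] := radius_bounds; have [_ rg _] := radius_bounds.
have -> : rho' *: P + E' - X' = (rho' - l) *: P + (Dl - h *: (Co + G)).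
  rewrite new_pointE /E'; generalize P Co G Dl => X1 X2 X3 X4.
  by apply/rowP => i; rewrite !mxE; ring.
apply: le_trans (enormD _ _) _; rewrite enormZ P1 mulr1.
have hrt : 0 <= h * growth by rewrite mulr_ge0 // ltW // growth_gt0.
have a1 : `|rho' - l| <= h * growth + d.
  have -> : rho' - l = (rho' - rho) + (rho - l) by ring.
  apply: le_trans (ler_normD _ _) _; rewrite lerD2r ger0_norm; first by lra.
  by lra.
have a2 : enorm (Dl - h *: (Co + G)) <= h * (M + 1) + h * (M + 1 + growth + 13 * K ^+ 2).
  apply: le_trans (enormB _ _) _; rewrite enormZ (gtr0_norm h0).
  apply: lerD; first exact: displacement_bound.
  rewrite ler_wpM2l ?(ltW h0) //; apply: le_trans (enormD _ _) _.
  by have := velocity_center_bound; have := G_bound; lra.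
have a3 : h * (2 * M + 5 + 13 * K ^+ 2) <= h * offset_const.
  by rewrite ler_wpM2l ?(ltW h0) // offset_const_ge.
have a4 : h * growth <= h * (1 / 8) by rewrite ler_wpM2l ?(ltW h0) // growth_le.
have h0' := h0; rewrite /j; lra.
Qed.

(** Every point of the new ball is carried into the old one by an admissible
    segment: [ball_push] leaves exactly the room that [back_segment] needs. *)
Lemma new_ball : epi_ball E rho -> epi_ball E' rho'.
Proof.
move=> hE y b' hy.
have [r0 rg rl] := radius_bounds; have Jj := contact_shift.
set Z := graph_pt y b' - E' in hy.
set J := rho' *: P + E' - X' in Jj.
have WJ : (Z - rho' *: P) + J = graph_pt (y - xh) (b' - (b + h)).
  have -> : graph_pt (y - xh) (b' - (b + h)) = graph_pt y b' - X' by rewrite !graph_ptE.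
  rewrite /J /Z; generalize (graph_pt y b') X' E' P => Y X1 X2 X3.
  by apply/rowP => i; rewrite !mxE; ring.
pose w := enorm (y - xh).
have w0 : 0 <= w by exact: enorm_ge0.
have wW : w <= enorm (Z - rho' *: P) + enorm J.
  apply: le_trans (enormD _ _); rewrite WJ; exact: enorm_graphl.
have W2 : enorm (Z - rho' *: P) <= 2 * rho'.
  by apply: le_trans (enormB _ _) _; rewrite enormZ P1 mulr1 (ger0_norm r0); lra.
have j2 : j <= 2 * max_radius.
  have hrt : 0 <= h * growth by rewrite mulr_ge0 // ltW // ?growth_gt0.
  by have := d_small; have := c1h; rewrite /j; lra.
have w4 : w <= 4 * max_radius by have := rho'_small; lra.
have rm0 := max_radius_gt0; have rm1 := max_radius_le1; have rmr := max_radius_le; have rt0 := growth_gt0.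
have Kw2 : K ^+ 2 * w ^+ 2 <= 16 / 100 * growth.
  have a1 : w ^+ 2 <= (4 * max_radius) ^+ 2.
    by rewrite ler_pXn2r ?nnegrE // mulr_ge0 // ltW.
  have a2 : K ^+ 2 * w ^+ 2 <= K ^+ 2 * (4 * max_radius) ^+ 2 by rewrite ler_wpM2l ?sqr_ge0.
  have a3 : growth * max_radius <= growth * 1 by rewrite ler_wpM2l ?(ltW rt0).
  have a4 : 100 * K ^+ 2 * max_radius * max_radius = growth * max_radius by rewrite max_radiusE.
  by rewrite !expr2 in a2 a4 *; lra.
pose Dv := graph_pt (V y N - V xh N) (0 : R).
have DvK : enorm Dv <= K * w by rewrite enorm_graph0; exact: V_lip.
have h0' := ltW h0; have K1' := K1.
have PD : - dotv P Dv >= enorm p * (dotv zt ((Z - rho' *: P) + J) - K * w ^+ 2 - K * h).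
  rewrite WJ /P /Dv /zt !dotv_graph mulr0 mul0r !addr0 dotv_p opprK.
  rewrite ler_wpM2l ?enorm_ge0 //.
  have := zetaP y; rewrite /mh /ham -/w !(dotvC _ N) !dotvDr !dotvNr.
  have : h <= K * h by rewrite ler_peMl.
  by lra.
have jG : j <= push_const * rho'.
  have hrt : 0 <= h * growth by rewrite mulr_ge0 // ltW.
  have a1 : h <= 2 / growth * rho'.
    by rewrite mulrAC ler_pdivlMr //; have := rho_ge0; lra.
  have a2 : offset_const * h <= offset_const * (2 / growth * rho').
    by rewrite ler_wpM2l //; have := offset_const_ge; have := M1; have := sqr_ge0 K; lra.
  have a3 : depth_const * rho <= depth_const * rho'.
    by rewrite ler_wpM2l ?depth_const_ge0 //; lra.
  rewrite /j /push_const; have := d_le; lra.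
have muE : rho' + h * (rho' * theta + 9 * K ^+ 2 * j
     + (K + (15 * K ^+ 2 + K * push_const) ^+ 2 / 2) * h - K ^+ 2 * w ^+ 2) =
   rho + h * (growth - K ^+ 2 * w ^+ 2 - 16 * K * M * h).
  have -> : rho = rho' + h * (rho' * theta) - h * (growth - 9 * K ^+ 2 * j - slack_const * h).
    by rewrite rho'E; ring.
  by rewrite /slack_const; generalize theta push_const => X1 X2; ring.
have KMh : 16 * K * M * h <= growth / 8.
  by apply: le_trans cBh; rewrite ler_wpM2r // slack_const_ge.
have rest0 : 0 <= growth - K ^+ 2 * w ^+ 2 - 16 * K * M * h by lra.
have push : enorm (Z + h *: (Dv - G)) <= rho + h * (growth - K ^+ 2 * w ^+ 2 - 16 * K * M * h).
  have zt3 : enorm zt <= 3 * K by rewrite enorm_graph0.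
  rewrite -muE; apply: (ball_push _ _ _ _ _ _ _ _ _ _ _ _ P1 hy _ _ K1' h0' zt3 w0
    DvK wW PD Jj _ push_const_ge0 jG).
  + by rewrite r0 /=; have := rho'_small; lra.
  + by rewrite enorm_ge0 p_le1.
  + by have := growth_le; lra.
  + by rewrite -/theta muE addr_ge0 ?rho_ge0 // mulr_ge0.
have ham2 : 8 * growth * (ham y N - mh) ^+ 2 <= K ^+ 2 * w ^+ 2.
  have a1 : `|ham y N - mh| <= K * w.
    rewrite /mh /ham -dotvNl -dotvDl.
    have a2 := V_lip y xh N N1; rewrite -/w in a2.
    have := cauchy_schwarz (V y N - V xh N) N.
    have := cauchy_schwarzN (V y N - V xh N) N.
    by rewrite N1 ler_norml; lra.
  have a3 : (ham y N - mh) ^+ 2 <= (K * w) ^+ 2.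
    rewrite -real_normK ?num_real // ler_pXn2r ?nnegrE // mulr_ge0 //.
    by lra.
  have a4 : 8 * growth * (ham y N - mh) ^+ 2 <= 1 * (ham y N - mh) ^+ 2.
    by rewrite ler_wpM2r ?sqr_ge0 //; have := growth_le; lra.
  by rewrite exprMn in a3; lra.
apply: (back_segment _ _ E rho h mh lam N) => //.
+ have := enorm_triangle y xh x0; have := xh_x0; have := growth_le.
  by rewrite -/w; lra.
+ by lra.
+ have -> : graph_pt y b' + h *: velocity_center y N mh lam - E = Z + h *: (Dv - G).
    have -> : velocity_center y N mh lam = Co + Dv.
      rewrite /Co /velocity_center addrAC /Dv graph_ptD addr0; congr (graph_pt _ _ + _).
      by rewrite addrC subrK.
    rewrite /Z /E'; generalize (graph_pt y b') Co Dv G => Y X1 X2 X3.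
    by apply/rowP => i; rewrite !mxE; ring.
  apply: (le_trans push); rewrite lerD2l ler_wpM2l //.
  by lra.
Qed.

Let U := - graph_pt (h^-1 *: (xk - xh)) (-1) + Co + G.

Lemma new_offset : X' - E' = l *: P + h *: U.
Proof.
have DlE : Dl = h *: graph_pt (h^-1 *: (xk - xh)) (-1).
  by rewrite graph_ptZ scalerA mulfV ?lt0r_neq0 // scale1r mulrN1.
rewrite new_pointE /E' /U DlE.
generalize Co G (graph_pt (h^-1 *: (xk - xh)) (-1)) P => X1 X2 X3 X4.
by apply/rowP => i; rewrite !mxE; ring.
Qed.

Lemma U_bound : enorm U <= offset_const.
Proof.
have a1 : enorm (graph_pt (h^-1 *: (xk - xh)) (-1)) <= M + 1.
  apply: le_trans (enorm_graph_le _ _) _; rewrite normrN1 lerD2r enormZ.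
  by rewrite gtr0_norm ?invr_gt0 // ler_pdivrMl // mulrC.
have a2 := enormD (- graph_pt (h^-1 *: (xk - xh)) (-1) + Co) G.
have a3 := enormD (- graph_pt (h^-1 *: (xk - xh)) (-1)) Co.
rewrite enormN in a3; rewrite -/U in a2.
have := velocity_center_bound; have := G_bound; have := growth_le; have := offset_const_ge.
by lra.
Qed.

(** The trajectory moves at most as far in direction [N] as the maximizer does, so
    relative to the moving ball it does not go outwards faster than the radius
    grows. *)
Lemma U_radial : dotv P U <= growth - rho' * theta + K * M * h.
Proof.
have rt0 := growth_gt0.
have KMh : 0 <= K * M * h.
  by rewrite !mulr_ge0 ?(ltW h0) //; [have := K1|have := M1]; lra.
have a1 : - dotv P (graph_pt (h^-1 *: (xk - xh)) (-1)) <= enorm p * (mh + K * M * h) + q.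
  rewrite dotv_graph dotv_p dotvZr.
  have : enorm p * (h^-1 * dotv N (xk - xh)) <= enorm p * (mh + K * M * h).
    by rewrite ler_wpM2l ?enorm_ge0 // ler_pdivrMl.
  by lra.
have a2 : dotv P Co <= - (enorm p * mh) - q + growth.
  rewrite /Co /velocity_center dotvDr dotvNr dotvZr dotv_graph dotv_p (dotvC N) -/(ham _ _) -/mh.
  have := cauchy_schwarzN P (graph_pt (lam *: N) (lam * mh)).
  rewrite P1 normal_unit mulr1 => a3.
  have : growth * - 1 <= growth * dotv P (graph_pt (lam *: N) (lam * mh)).
    by rewrite ler_wpM2l // ltW.
  by lra.
have a3 : dotv P G = - (rho' * theta).
  rewrite /G /theta dotvDr dotvNr !dotvZr P_sqr (dotvC P zt); ring.
have a4 : enorm p * (K * M * h) <= K * M * h by rewrite ler_piMl // p_le1.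
rewrite /U (dotvDr P (_ + _) G) (dotvDr P (- _) Co) (dotvNr P (graph_pt _ _)) a3.
by lra.
Qed.

Lemma new_offset_le : enorm (X' - E') <= l + offset_const * h.
Proof.
rewrite new_offset; apply: le_trans (enormD _ _) _.
rewrite !enormZ P1 mulr1 (ger0_norm (enorm_ge0 _)) (ger0_norm (ltW h0)) lerD2l mulrC.
by rewrite ler_wpM2r ?(ltW h0) // U_bound.
Qed.

Lemma new_depth : 0 < l -> enorm (X' - E') - rho' <=
  (l - rho) + 9 * K ^+ 2 * h * d + h ^+ 2 * (error_const + error_const / l).
Proof.
move=> l0; rewrite new_offset.
have K1' := K1; have M1' := M1; have rt0 := growth_gt0.
have KM0 : 0 <= K * M by rewrite mulr_ge0 //; lra.
have [r0 rg rl] := radius_bounds; have /andP[t0 t1] := theta_bounds.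
have chi0 : 0 <= growth - rho' * theta + K * M * h.
  have KMh : 0 <= K * M * h by rewrite mulr_ge0 // ltW.
  have : rho' * theta <= max_radius * (13 * K ^+ 2) by apply: ler_pM => //; exact: rho'_small.
  by have := max_radiusE; lra.
have R1 := radial_displacement P U l h _ offset_const P1 l0 (ltW h0) chi0 U_radial U_bound.
have E1 := rho'E.
have E2 : h ^+ 2 * offset_const ^+ 2 / (2 * l) = h ^+ 2 * (offset_const ^+ 2 / 2 / l).
  by field; rewrite lt0r_neq0.
have c10 := offset_const_ge0.
have cK0 : 0 <= K ^+ 2 * offset_const by rewrite mulr_ge0 ?sqr_ge0.
have c1s := sqr_ge0 offset_const; have cB0 := slack_const_ge0.
have a1 : h ^+ 2 * (offset_const ^+ 2 / 2 / l) <= h ^+ 2 * (error_const / l).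
  rewrite ler_wpM2l ?sqr_ge0 // ler_pM2r ?invr_gt0 // /error_const.
  by lra.
have a2 : h ^+ 2 * (slack_const + 9 * K ^+ 2 * offset_const + K * M) <= h ^+ 2 * error_const.
  by rewrite ler_wpM2l ?sqr_ge0 // /error_const; lra.
rewrite E2 in R1; move: R1; set LHS := enorm _ => R1.
rewrite /j in E1; lra.
Qed.

End OneStep.

(** The trajectory point leaves the ball by second order terms only.  The estimate
    of the excess degenerates when the point is close to the centre, where the
    crude bound on the new distance is used instead. *)
Lemma backward_step xk xh (b h rho : R) E N0 :
  enorm (N0 : 'rV[R]_n) = 1 ->
  let l := enorm (graph_pt xk b - E) in
  enorm (xh - x0) <= 1 -> 0 < h -> offset_const * h <= max_radius -> slack_const * h <= growth / 8 ->
  0 <= rho -> rho + h * growth <= max_radius -> epi_ball E rho ->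
  `|rho - l| <= depth_const * rho -> `|rho - l| <= max_radius ->
  enorm (xk - xh) <= M * h ->
  (forall N, enorm N = 1 -> dotv N (xk - xh) <= h * (ham xh N + K * M * h)) ->
  exists E' rho',
    [/\ rho + h * growth / 2 <= rho' <= rho + h * growth,
        epi_ball E' rho',
        enorm (graph_pt xh (b + h) - E') <= l + offset_const * h &
        0 < l -> enorm (graph_pt xh (b + h) - E') - rho' <=
          (l - rho) + 9 * K ^+ 2 * h * `|rho - l| + h ^+ 2 * (error_const + error_const / l)].
Proof.
move=> N01 l xhx0 h0 hc1 hcB rho0 rhom hE hl hl' xkxh hN.
have h1 : 0 < h <= 1.
  by rewrite h0 /=; have := c1h_ge h h0; have := max_radius_le1; lra.
have e1 : enorm (graph_pt (0 : 'rV[R]_n) (1 : R)) = 1.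
  by rewrite /enorm dotv_graph dotv0l add0r mulr1 sqrtr1.
have [P P1 XE] := polar (graph_pt xk b - E) _ e1.
have [p [q PE]] := graph_pt_surj P; rewrite {}PE in P1 XE *.
have [N N1] := polar (- p) _ N01; rewrite enormN => pE.
have [zeta zeta3 hz] := ham_support xh N h N1 h1.
have mh1 : 0 < 1 + ham xh N ^+ 2 by rewrite ltr_wpDr ?sqr_ge0.
pose lam := (Num.sqrt (1 + ham xh N ^+ 2))^-1.
have lam0 : 0 < lam by rewrite invr_gt0 sqrtr_gt0.
have lamE : lam ^+ 2 * (1 + ham xh N ^+ 2) = 1.
  by rewrite exprVn sqr_sqrtr ?(ltW mh1) // mulVf // lt0r_neq0.
clearbody lam.
have /andP[t0 _] := theta_bounds zeta p q P1 zeta3.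
set theta := enorm p * _ + _ in t0.
have hth : 0 < 1 + h * theta by rewrite ltr_wpDr // mulr_ge0 // ltW.
pose rho' := (rho + h * (growth - 9 * K ^+ 2 * (`|rho - l| + offset_const * h) - slack_const * h)) / (1 + h * theta).
have rho'E : rho' + h * (rho' * theta) =
    rho + h * (growth - 9 * K ^+ 2 * (`|rho - l| + offset_const * h) - slack_const * h).
  have -> : rho' + h * (rho' * theta) = rho' * (1 + h * theta) by ring.
  by rewrite divfK // lt0r_neq0.
clearbody rho'.
have drift := hN N N1.
have [r0 rg rl] := radius_bounds _ _ _ _ _ _ _ _ _ h0 hc1 hcB rho0 rhom hl' P1 zeta3 rho'E.
exists (E - h *: velocity_center xh N (ham xh N) lam -
   h *: (- (rho' * enorm p) *: graph_pt zeta 0 - (10 * K ^+ 2 * rho') *: graph_pt p q)), rho'.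
split.
- by rewrite rg.
- exact: (new_ball xk xh zeta N p b h rho rho' q lam E).
- exact: (new_offset_le xk xh zeta N p b h rho rho' q lam E).
- exact: (new_depth xk xh zeta N p b h rho rho' q lam E).
Qed.

End BackwardStep.

(** * Balls along a trajectory *)

Section AlongTrajectory.
Context {R : realType} {n : nat}.
Variables (F : 'rV[R]_n -> set 'rV[R]_n) (S : set 'rV[R]_n).
Variables (K r M : R) (x0 N0 : 'rV[R]_n).
Implicit Types (x u N : 'rV[R]_n) (E P : 'rV[R]_(n + 1)).

Let V x N := maximizer F x N.
Let ham x N := dotv (V x N) N.

Hypothesis K1 : 1 <= K.
Hypothesis M1 : 1 <= M.
Hypothesis r_gt0 : 0 < r.
Hypothesis rM : r <= M.
Hypothesis V_ball : forall x N u, enorm N = 1 ->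
  enorm (u - (V x N - r *: N)) <= r -> F x u.
Hypothesis V_max : forall x N u, F x u -> dotv u N <= ham x N.
Hypothesis V_lip : forall x y N, enorm N = 1 ->
  enorm (V x N - V y N) <= K * enorm (x - y).
Hypothesis F_bound : forall x u, enorm (x - x0) <= 2 -> F x u -> enorm u <= M.
Hypothesis ham_support : forall x N (eta : R), enorm N = 1 -> 0 < eta <= 1 ->
  exists2 zeta, enorm zeta <= 3 * K & forall y,
    ham x N + dotv zeta (y - x) - K * enorm (y - x) ^+ 2 - eta <= ham y N.
Hypothesis N01 : enorm N0 = 1.

Variables (y : R -> 'rV[R]_n) (tau b0 : R).
Hypothesis ty : trajectory F x0 y.
Hypothesis tau0 : 0 < tau.
Hypothesis tau_le : 100 * M * K ^+ 2 * tau <= 1.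
Hypothesis T_end : (min_time F S (y tau) <= b0%:E)%E.

Let rt := growth r M.
Let c1 := offset_const K M.
Let c2 := error_const K r M.
Let cB := slack_const K r M.
Let cD := depth_const K r M.
Let rmax := max_radius K r M.

Lemma tau_M : M * tau <= 1 / 2.
Proof.
have M1' := M1; have K2 : 1 <= K ^+ 2 by rewrite exprn_ege1.
have : M * tau * 1 <= M * tau * K ^+ 2.
  by rewrite ler_wpM2l // mulr_ge0 ?(ltW tau0) //; lra.
by have := tau_le; lra.
Qed.

Lemma tau_rmax : rt * tau <= rmax.
Proof.
have K2 : 1 <= K ^+ 2 by rewrite exprn_ege1.
have K0 : 0 < 100 * K ^+ 2 by lra.
rewrite /rmax /max_radius ler_pdivlMr // -mulrA ler_piMr ?(ltW (growth_gt0 r M r_gt0)) //.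
have : 1 * (K ^+ 2 * tau) <= M * (K ^+ 2 * tau).
  by rewrite ler_wpM2r // mulr_ge0 ?(ltW tau0) //; lra.
by have := tau_le; lra.
Qed.

Lemma tau_K : 18 * K ^+ 2 * tau <= 1.
Proof.
have K2 := sqr_ge0 K.
have : 1 * (K ^+ 2 * tau) <= M * (K ^+ 2 * tau).
  by rewrite ler_wpM2r // mulr_ge0 ?(ltW tau0).
have : 0 <= K ^+ 2 * tau by rewrite mulr_ge0 ?(ltW tau0).
by have := tau_le; lra.
Qed.

Lemma traj_near s : 0 <= s <= tau -> enorm (y s - x0) <= 1 / 2.
Proof.
move=> /andP[s0 st]; have M1' := M1.
have := trajectory_bound F x0 y M tau ty; move=> /(_ _ _ (ltW tau0) tau_M s).
rewrite s0 st => h.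
have {}h : enorm (y s - x0) <= M * s.
  apply: h => // [z u zx|]; last by lra.
  by apply: F_bound; lra.
have : M * s <= M * tau by rewrite ler_wpM2l //; lra.
by have := tau_M; lra.
Qed.

Lemma traj_speed s t : 0 <= s -> s <= t -> t <= tau ->
  enorm (y t - y s) <= M * (t - s).
Proof.
move=> s0 st tt; have M1' := M1.
apply: (trajectory_speed F x0 y M s t ty) => //; first by lra.
move=> w u /andP[sw wt]; apply: F_bound.
by have := traj_near w; rewrite (le_trans s0 sw) (le_trans wt tt) => /(_ isT); lra.
Qed.

Lemma traj_drift s t N : 0 <= s -> s <= t -> t <= tau -> enorm N = 1 ->
  dotv N (y t - y s) <= (t - s) * (ham (y s) N + K * M * (t - s)).
Proof.
move=> s0 st tt N1; have K1' := K1; have M1' := M1; rewrite mulrC.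
apply: (trajectory_drift F x0 y N _ s t ty) => // w u /andP[sw wt] Fu.
rewrite dotvC; apply: le_trans (V_max _ N _ Fu) _.
have a1 := V_lip (y w) (y s) N N1.
have a2 := traj_speed s w s0 sw (le_trans wt tt).
have a3 : K * enorm (y w - y s) <= K * (M * (w - s)) by rewrite ler_wpM2l //; lra.
have a4 : K * M * (w - s) <= K * M * (t - s).
  by rewrite ler_wpM2l ?mulr_ge0 //; lra.
have := cauchy_schwarz (V (y w) N - V (y s) N) N.
by rewrite N1 dotvDl dotvNl /ham; lra.
Qed.

Let step := backward_step F S K r M x0 K1 M1 r_gt0 rM V_ball V_lip F_bound ham_support.

(** The ball at backward time [t] has radius of order [t]; the excess [e] measures
    how far the trajectory point may lie outside of it. *)
Definition tracked (t e : R) := exists E rho,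
  [/\ rt * t / 2 <= rho, rho <= rt * t, epi_ball F S E rho &
      enorm (graph_pt (y (tau - t)) (b0 + t) - E) - rho <= e].

Let rt0 : 0 < rt := growth_gt0 r M r_gt0.
Let c10 : 0 <= c1 := offset_const_ge0 K M K1 M1.

(** From a single point the first step already produces a ball, at the price of
    an offset proportional to the step. *)
Lemma tracked_first eta : 0 < eta <= tau -> c1 * eta <= rmax ->
  cB * eta <= rt / 8 -> tracked eta (c1 * eta).
Proof.
move=> /andP[e0 et] h1 h2.
pose E0 := graph_pt (y tau) b0.
have ball0 : epi_ball F S E0 0.
  move=> x b; have := enorm_ge0 (graph_pt x b - E0) => n0 n1.
  have /eqP : enorm (graph_pt x b - E0) = 0 by lra.
  rewrite enorm_eq0 subr_eq0 => /eqP/eq_row_mx[-> bE].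
  suff -> : b = b0 by exact: T_end.
  by have /rowP/(_ ord0) := bE; rewrite !mxE !mulr1n.
have l0 : enorm (graph_pt (y tau) b0 - E0) = 0 by rewrite subrr enorm0.
have dE : `|0 - enorm (graph_pt (y tau) b0 - E0)| = 0 by rewrite l0 subrr normr0.
have tau0' := tau0.
have [||||||E' [rho' [/andP[r1 r2] hb hl _]]] := step (y tau) (y (tau - eta)) b0 eta 0 E0 N0 N01
  _ e0 h1 h2 (lexx _) _ ball0.
- by have := traj_near (tau - eta); rewrite subr_ge0 et gerBl (ltW e0) => /(_ isT); lra.
- rewrite add0r; apply: le_trans tau_rmax.
  by rewrite mulrC ler_wpM2l ?(ltW rt0).
- by rewrite dE mulr0.
- by rewrite dE (ltW (max_radius_gt0 K r M K1 r_gt0)).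
- by have := traj_speed (tau - eta) tau; rewrite subr_ge0 gerBl => /(_ et (ltW e0) (lexx _)); lra.
- move=> N N1; have := traj_drift (tau - eta) tau N.
  have -> : tau - (tau - eta) = eta by ring.
  by rewrite subr_ge0 gerBl => /(_ et (ltW e0) (lexx _) N1).
exists E', rho'; split => //; try by move: r1 r2; rewrite -/rt; lra.
have rr : 0 <= rho'.
  have : 0 <= rt * eta by rewrite mulr_ge0 // ltW.
  by move: r1; rewrite -/rt; lra.
by move: hl; rewrite l0 add0r -/c1; lra.
Qed.

(** The excess is multiplied by [1 + O(h)] and increased by [O(h^2)], the constant
    depending on the radius already gained. *)
Lemma tracked_next eta h t e : 0 < eta -> 0 < h -> eta <= t -> t + h <= tau ->
  c1 * h <= rt * eta / 4 -> c1 * h <= rmax -> cB * h <= rt / 8 ->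
  9 * K ^+ 2 * h <= 1 ->
  0 <= e -> e <= 4 * c1 * eta -> e <= rmax ->
  tracked t e ->
  tracked (t + h) (e * (1 + 9 * K ^+ 2 * h) + h * (h * (c2 + c2 * (4 / (rt * eta))))).
Proof.
move=> eta0 h0 et tht h1 h2 h3 h4 e0 e1 e2 [E [rho [r1 r2 hb]]].
set l := enorm _ => hl; have rt0' := rt0; have c10' := c10.
have rteta : 0 < rt * eta by rewrite mulr_gt0.
have rtt : rt * eta <= rt * t by rewrite ler_wpM2l // ltW.
have rho0 : 0 < rho by lra.
have l_ge0 : 0 <= l by exact: enorm_ge0.
have c20 : 0 <= c2.
  have K2 := sqr_ge0 K; have := slack_const_ge0 K r M K1 M1.
  have : 0 <= K * M by rewrite mulr_ge0 //; [have := K1|have := M1]; lra.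
  have : 0 <= K ^+ 2 * c1 by rewrite mulr_ge0.
  by have := sqr_ge0 c1; rewrite /c2 /error_const -/c1; lra.
have dle : `|rho - l| <= Num.max rho e.
  rewrite le_max ler_norml; have [rl|lr] := leP l rho.
    by apply/orP; left; lra.
  by apply/orP; right; rewrite ler_norml; lra.
have hrt : rt * (t + h) <= rmax.
  by apply: le_trans tau_rmax; rewrite ler_wpM2l // ltW.
have rtt' : rt * (t + h) = rt * t + h * rt by ring.
have d1 : `|rho - l| <= cD * rho.
  apply: (le_trans dle); rewrite ge_max; apply/andP; split.
    have cD1 : 1 <= cD.
      rewrite /cD /depth_const ler_pdivlMr // mul1r -/c1.
      have := growth_le r M rM; have := offset_const_ge K M K1 M1; have := M1; have := sqr_ge0 K.
      by rewrite -/c1 -/rt; lra.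
    by rewrite ler_peMl // ltW.
  apply: (le_trans e1); rewrite /cD /depth_const -/c1 [leRHS]mulrAC ler_pdivlMr //.
  have : c1 * (rt * eta) <= c1 * (2 * rho) by rewrite ler_wpM2l //; lra.
  by rewrite -/rt; lra.
have d2 : `|rho - l| <= rmax.
  apply: (le_trans dle); rewrite ge_max e2 andbT.
  by have : 0 <= h * rt by [rewrite mulr_ge0 // ltW]; lra.
have tau0' := tau0; have t0 : 0 < t by lra.
pose t1 := tau - t; pose t2 := tau - (t + h).
have t12 : t1 - t2 = h by rewrite /t1 /t2; ring.
have t2_ge0 : 0 <= t2 by rewrite /t2; lra.
have t21 : t2 <= t1 by lra.
have t1tau : t1 <= tau by rewrite /t1; lra.
have [||||E' [rho' [/andP[r1' r2'] hb' hl1 hl2]]] := step (y t1) (y t2) (b0 + t) h rho E N0 N01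
  _ h0 h2 h3 (ltW rho0) _ hb d1 d2.
- by have := traj_near t2; rewrite t2_ge0 (le_trans t21 t1tau) => /(_ isT); lra.
- by change (rho + h * rt <= rmax); lra.
- by have := traj_speed t2 t1 t2_ge0 t21 t1tau; rewrite t12.
- by move=> N N1; have := traj_drift t2 t1 N t2_ge0 t21 t1tau N1; rewrite t12.
rewrite -/rt in r1' r2'.
exists E', rho'; split => //.
- by lra.
- by lra.
rewrite addrA -/t2 -/c1 -/c2 -/t1 -/l in hl1 hl2 *.
set l' := enorm _ in hl1 hl2 *.
have A0 : 0 <= 9 * K ^+ 2 * h by rewrite mulr_ge0 ?(ltW h0) // mulr_ge0 ?sqr_ge0.
have res0 : 0 <= h * (h * (c2 + c2 * (4 / (rt * eta)))).
  rewrite mulr_ge0 ?(ltW h0) // mulr_ge0 ?(ltW h0) // addr_ge0 // mulr_ge0 //.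
  by rewrite divr_ge0 // ltW.
have eA : 0 <= e * (9 * K ^+ 2 * h) by rewrite mulr_ge0.
have hrt0 : 0 <= h * rt by rewrite mulr_ge0 // ltW.
have [lsmall|lbig] := leP l (rho / 2); first by lra.
have lpos : 0 < l by lra.
have a1 : h ^+ 2 * (c2 + c2 / l) <= h * (h * (c2 + c2 * (4 / (rt * eta)))).
  rewrite expr2 -mulrA ler_wpM2l ?(ltW h0) // ler_wpM2l ?(ltW h0) // lerD2l.
  rewrite ler_wpM2l // ler_pdivlMr // mulrC ler_pdivrMr //; lra.
have a2 : (l - rho) + 9 * K ^+ 2 * h * `|rho - l| <= e * (1 + 9 * K ^+ 2 * h).
  have [rl|lr] := leP l rho.
    rewrite ger0_norm ?subr_ge0 //.
    have : 9 * K ^+ 2 * h * (rho - l) <= 1 * (rho - l) by rewrite ler_wpM2r ?subr_ge0.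
    by lra.
  rewrite distrC gtr0_norm ?subr_gt0 //.
  have : 9 * K ^+ 2 * h * (l - rho) <= 9 * K ^+ 2 * h * e by rewrite ler_wpM2l.
  by lra.
by have := hl2 lpos; lra.
Qed.

Lemma tracked_le t e e' : e <= e' -> tracked t e -> tracked t e'.
Proof.
by move=> ee [E [rho [r1 r2 hb hl]]]; exists E, rho; split=> //; exact: le_trans hl ee.
Qed.

(** One step of length [eta], then many steps of a length [h] negligible before
    [eta]: the accumulated excess is of order [eta + h / eta].  The bound [err]
    is a discrete Gronwall estimate, linear because [K^2 tau] is small. *)
Lemma tracked_all e : 0 < e -> tracked tau e.
Proof.
move=> e0; have rt0' := rt0; have tau0' := tau0; have K2 := sqr_ge0 K.
have rm0 : 0 < rmax := max_radius_gt0 K r M K1 r_gt0.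
have c1p : 0 < c1 by have := offset_const_ge K M K1 M1; have := M1; rewrite -/c1; lra.
have cB0 : 0 <= cB := slack_const_ge0 K r M K1 M1.
have KM0 : 0 <= K * M.
  by rewrite mulr_ge0 //; [have := K1|have := M1]; lra.
have c20 : 0 <= c2.
  have : 0 <= K ^+ 2 * c1 by rewrite mulr_ge0.
  by have := sqr_ge0 c1; rewrite /c2 /error_const -/c1 -/cB; lra.
have [eta [eta0 et eta1]] : exists eta, [/\ 0 < eta, eta <= tau / 2 &
    (4 * c1 + cB) * eta <= Num.min rmax (Num.min (rt / 8) e)].
  apply: small_enough; [lra|lra|].
  by rewrite !lt_min rm0 e0 andbT divr_gt0.
move: eta1; rewrite !le_min => /and3P[eta1 eta2 eta3].
have c1eta : 0 <= c1 * eta by rewrite mulr_ge0 // ltW.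
have cBeta : 0 <= cB * eta by rewrite mulr_ge0 // ltW.
pose D := c2 + c2 * (4 / (rt * eta)).
have D0 : 0 <= D.
  by rewrite addr_ge0 // mulr_ge0 // divr_ge0 // ltW // mulr_gt0.
have tD : 0 <= tau * D by rewrite mulr_ge0 // ltW.
have c1eta0 : 0 < c1 * eta by rewrite mulr_gt0.
have rteta : 0 < rt * eta / 4 by rewrite divr_gt0 // mulr_gt0.
have [hb [hb0 _ hb1]] : exists hb, [/\ 0 < hb, hb <= 1 &
    (c1 + cB + 9 * K ^+ 2 + tau * D) * hb <=
      Num.min (rt * eta / 4) (Num.min rmax (Num.min (rt / 8) (Num.min 1 (c1 * eta))))].
  apply: small_enough; [lra|lra|].
  by rewrite !lt_min rteta rm0 ltr01 c1eta0 divr_gt0.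
(* equal steps below the bound just found *)
pose k := Num.bound ((tau - eta) / hb).
have k_gt : (tau - eta) / hb < k%:R.
  by apply: archi_boundP; rewrite divr_ge0 ?(ltW hb0) // subr_ge0; lra.
have k0 : 0 < k%:R :> R by apply: le_lt_trans k_gt; rewrite divr_ge0 ?(ltW hb0) //; lra.
pose h := (tau - eta) / k%:R.
have h0 : 0 < h by rewrite divr_gt0 //; lra.
have hhb : h <= hb.
  by rewrite /h ler_pdivrMr // mulrC -ler_pdivrMr // ltW.
have kh : k%:R * h = tau - eta by rewrite mulrC divfK // lt0r_neq0.
have hc : (c1 + cB + 9 * K ^+ 2 + tau * D) * h <=
    Num.min (rt * eta / 4) (Num.min rmax (Num.min (rt / 8) (Num.min 1 (c1 * eta)))).
  apply: le_trans hb1; rewrite ler_wpM2l //; lra.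
move: hc; rewrite !le_min => /andP[h1 /and4P[h2 h3 h4 h5]].
have p1 : 0 <= c1 * h by rewrite mulr_ge0 // ltW.
have p2 : 0 <= cB * h by rewrite mulr_ge0 // ltW.
have p3 : 0 <= K ^+ 2 * h by rewrite mulr_ge0 // ltW.
have p4 : 0 <= tau * D * h by rewrite mulr_ge0 // ltW.
have tK := tau_K.
pose err (i : nat) := (c1 * eta + i%:R * h * (h * D)) * (1 + 18 * K ^+ 2 * (i%:R * h)).
have err_le i : i%:R * h <= tau -> [/\ 0 <= i%:R * h * (h * D),
    18 * K ^+ 2 * (i%:R * h) <= 1, 0 <= err i & err i <= 4 * c1 * eta].
  move=> ih; have i0 : 0 <= i%:R * h by rewrite mulr_ge0 // ltW.
  have a1 : 0 <= i%:R * h * (h * D) by rewrite mulr_ge0 // mulr_ge0 // ltW.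
  have a2 : i%:R * h * (h * D) <= tau * (h * D).
    by rewrite ler_wpM2r // mulr_ge0 // ltW.
  have a3 : 0 <= 18 * K ^+ 2 * (i%:R * h) by rewrite mulr_ge0 // mulr_ge0.
  have a4 : 18 * K ^+ 2 * (i%:R * h) <= 1.
    by apply: le_trans tK; rewrite ler_wpM2l // mulr_ge0.
  split=> //; first by rewrite mulr_ge0 // addr_ge0.
  have : err i <= (2 * (c1 * eta)) * 2.
    by apply: ler_pM; rewrite ?addr_ge0 //; lra.
  by lra.
suff : forall i, (i <= k)%N -> tracked (eta + i%:R * h) (err i).
  move=> /(_ k (leqnn k)); rewrite kh addrC subrK.
  by apply: tracked_le; have [|_ _ _] := err_le k; rewrite ?kh; lra.
elim=> [_|i IH ik].
  rewrite /err mul0r addr0 !mul0r !mulr0 !addr0 mulr1.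
  by apply: tracked_first; rewrite ?eta0 /=; lra.
have ihle : (i%:R + 1) * h <= tau - eta.
  by rewrite -kh ler_wpM2r ?(ltW h0) // natr1 ler_nat.
have [|q1 q2 q3 q4] := err_le i; first by lra.
have i0 : 0 <= i%:R * h by rewrite mulr_ge0 // ltW.
have -> : eta + i.+1%:R * h = (eta + i%:R * h) + h by rewrite -natr1; ring.
have := tracked_next eta h (eta + i%:R * h) (err i) eta0 h0.
rewrite lerDl i0 => /(_ isT) tn.
apply: tracked_le (tn _ _ _ _ _ _ _ _ _); rewrite -/D; try lra; last by apply: IH; exact: ltnW.
have -> : err i.+1 = (c1 * eta + i%:R * h * (h * D) + h * (h * D)) *
    (1 + 18 * K ^+ 2 * (i%:R * h) + 18 * K ^+ 2 * h).
  by rewrite /err -natr1; ring.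
rewrite /err; set X := c1 * eta + _ in q4 *; set Y := 18 * K ^+ 2 * (i%:R * h) in q2 *.
have X0 : 0 <= X by rewrite addr_ge0.
have Y0 : 0 <= Y by rewrite /Y mulr_ge0 // mulr_ge0.
have HD : 0 <= h * (h * D).
  by apply: mulr_ge0; [exact: ltW|apply: mulr_ge0 => //; exact: ltW].
have s1 : X * (Y * (9 * K ^+ 2 * h)) <= X * (1 * (9 * K ^+ 2 * h)).
  by rewrite ler_wpM2l // ler_wpM2r // -mulrA mulr_ge0.
have s2 : 0 <= h * (h * D) * (Y + 18 * K ^+ 2 * h).
  by rewrite mulr_ge0 // addr_ge0 // -mulrA mulr_ge0.
by lra.
Qed.

End AlongTrajectory.

(** * Exterior spheres *)

Section ExteriorBall.
Context {R : realType} {n : nat}.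
Variables (F : 'rV[R]_n -> set 'rV[R]_n) (S : set 'rV[R]_n).
Variables (K r M : R) (x0 N0 : 'rV[R]_n).
Implicit Types (x u N : 'rV[R]_n).

Hypothesis K1 : 1 <= K.
Hypothesis M1 : 1 <= M.
Hypothesis r_gt0 : 0 < r.
Hypothesis rM : r <= M.
Hypothesis V_ball : forall x N u, enorm N = 1 ->
  enorm (u - (maximizer F x N - r *: N)) <= r -> F x u.
Hypothesis V_max : forall x N u, F x u -> dotv u N <= dotv (maximizer F x N) N.
Hypothesis V_lip : forall x y N, enorm N = 1 ->
  enorm (maximizer F x N - maximizer F y N) <= K * enorm (x - y).
Hypothesis F_bound : forall x u, enorm (x - x0) <= 2 -> F x u -> enorm u <= M.
Hypothesis ham_support : forall x N (eta : R), enorm N = 1 -> 0 < eta <= 1 ->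
  exists2 zeta, enorm zeta <= 3 * K & forall y,
    dotv (maximizer F x N) N + dotv zeta (y - x) - K * enorm (y - x) ^+ 2 - eta
    <= dotv (maximizer F y N) N.
Hypothesis N01 : enorm N0 = 1.

(** An almost optimal trajectory, cut at time [tau], is followed backwards from
    [tau] to [0]. *)
Lemma min_time_epi_ball (T0 tau : R) :
  min_time F S x0 = T0%:E -> 0 < tau -> tau <= T0 ->
  100 * M * K ^+ 2 * tau <= 1 ->
  exists2 nu : 'rV[R]_(n + 1), enorm nu = 1 & forall Y,
    enorm (Y - (graph_pt x0 T0 + (growth r M * tau / 4) *: nu)) < growth r M * tau / 4 ->
    forall y b, Y = graph_pt y b -> (min_time F S y <= b%:E)%E.
Proof.
move=> TE tau0 tauT tau_le; have rt0 := growth_gt0 r M r_gt0.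
apply: (touching_ball_limit _ _ [set Y | forall y b, Y = graph_pt y b -> (min_time F S y <= b%:E)%E]).
  by rewrite divr_gt0 // mulr_gt0.
move=> e e0.
have /min_time_ltP[y [t [ty t0 tT Syt]]] : (min_time F S x0 < (T0 + e / 2)%:E)%E.
  by rewrite TE lte_fin; lra.
have Tt : T0 <= t.
  have [_ yx0 _] := ty.
  by have := min_time_along F S x0 y t 0 ty (lexx _) t0 Syt; rewrite yx0 TE subr0 lee_fin.
have taut : tau <= t by lra.
have Tend := min_time_along F S x0 y t tau ty (ltW tau0) taut Syt.
have e2 : 0 < e / 2 by lra.
have [E [rho [r1 r2 hb hl]]] := tracked_all F S K r M x0 N0 K1 M1 r_gt0 rM V_ball V_max V_lip
  F_bound ham_support N01 y tau (t - tau) ty tau0 tau_le Tend (e / 2) e2.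
have [_ yx0 _] := ty; rewrite subrr yx0 subrK in hl.
have e11 : enorm (graph_pt (0 : 'rV[R]_n) (1 : R)) = 1.
  by rewrite /enorm dotv_graph dotv0l add0r mulr1 sqrtr1.
have XE : enorm (graph_pt x0 T0 - E) <= rho + e.
  apply: le_trans (enorm_triangle _ (graph_pt x0 t) _) _.
  have : enorm (graph_pt x0 T0 - graph_pt x0 t) <= e / 2.
    rewrite !graph_ptE subrr; apply: le_trans (enorm_graph_le _ _) _.
    by rewrite enorm0 add0r distrC ger0_norm ?subr_ge0 //; lra.
  lra.
have [|nu nu1 hnu] := touching_ball (graph_pt x0 T0) E _ rho (growth r M * tau / 4) e e11 (ltW e0) _ XE.
  lra.
exists nu => // Y hY z b YE; apply: hb; rewrite -YE; exact: hnu.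
Qed.

End ExteriorBall.

Section Uniformity.
Context {R : realType} {n : nat}.
Variables (F : 'rV[R]_n -> set 'rV[R]_n) (S : set 'rV[R]_n).

(** Speeds are bounded near [x], so a trajectory needs some time to reach the
    closed set [S]. *)
Lemma min_time_gt0 (M : R) x : closed S -> ~ S x -> 0 <= M ->
  (forall z u, enorm (z - x) <= 1 -> F z u -> enorm u <= M) ->
  exists2 b : R, 0 < b & (b%:E <= min_time F S x)%E.
Proof.
move=> Scl nSx M0 hM.
have : nbhs x (~` S).
  by apply: open_nbhs_nbhs; split=> //; exact: closed_openC.
move=> /nbhs_enormP[d d0 hd].
pose b := Num.min (1 / 2) d / (M + 1).
have m0 : 0 < Num.min (1 / 2) d by rewrite lt_min d0 divr_gt0.
have M1 : 0 < M + 1 by lra.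
have bE : b * (M + 1) = Num.min (1 / 2) d by rewrite divfK // lt0r_neq0.
have b0 : 0 < b by rewrite divr_gt0.
exists b => //; rewrite leNgt; apply/negP => /min_time_ltP[y [t [ty t0 tb Syt]]].
have Mt : M * t <= Num.min (1 / 2) d - t.
  have : (M + 1) * t <= (M + 1) * b by rewrite ler_wpM2l // ltW.
  lra.
have m1 : Num.min (1 / 2) d <= 1 / 2 by rewrite ge_min lexx.
have m2 : Num.min (1 / 2) d <= d by rewrite ge_min lexx orbT.
have := trajectory_bound F x y M t ty hM M0 t0.
move=> /(_ _ t); rewrite t0 lexx => h.
have {}h : enorm (y t - x) <= M * t by apply: h => //; lra.
have [t00|tn0] := eqVneq t 0.
  by have [_ y0 _] := ty; apply: nSx; rewrite -y0 -t00.
have tp : 0 < t by rewrite lt_def tn0.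
by apply: (hd (y t)) => //; rewrite enormBC; lra.
Qed.

End Uniformity.

Lemma cvg_radius {R : realType} {U : Type} (G : set_system U) {FG : Filter G}
    (r k : R) (t m : U -> R) (t0 m0 : R) : 0 < t0 -> 0 <= m0 -> 0 <= k ->
  t @ G --> t0 -> m @ G --> m0 ->
  (fun u => growth r (m u) * (t u / (2 + 200 * m u * k * t u)) / 4) @ G -->
  growth r m0 * (t0 / (2 + 200 * m0 * k * t0)) / 4.
Proof.
move=> t_gt0 m_ge0 k_ge0 ct cm.
have cc (c : R) : (fun=> c : R) @ G --> c by exact: cvg_cst.
have D1 : 4 * (1 + m0 ^+ 2) != 0 by rewrite lt0r_neq0 // mulr_gt0 // ltr_wpDr ?sqr_ge0.
have P0 : 0 <= m0 * k * t0 by rewrite mulr_ge0 ?(ltW t_gt0) // mulr_ge0.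
have D2 : 2 + 200 * m0 * k * t0 != 0 by rewrite lt0r_neq0 //; lra.
have c1 : (fun u => growth r (m u)) @ G --> growth r m0.
  apply: cvgM => //; apply: cvgV => //; apply: cvgM => //; apply: cvgD => //.
  by rewrite expr2; apply: cvgM.
have c2 : (fun u => t u / (2 + 200 * m u * k * t u)) @ G --> t0 / (2 + 200 * m0 * k * t0).
  apply: cvgM => //; apply: cvgV => //; apply: cvgD => //; apply: cvgM => //.
  by apply: cvgM => //; apply: cvgM.
by apply: cvgM => //; apply: cvgM.
Qed.

Theorem theorem4p9 (R : realType) (n : nat)
    (F : 'rV[R]_n -> set 'rV[R]_n)
    (hF1 : F1 F) (hF2 : F2 F) (hH1 : H1 F) (hH2 : H2 F)
    (r : R) (hr : 0 < r) (hball : forall x, inner_ball_property (F x) r)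
    (S : set 'rV[R]_n) (S_neq0 : S !=set0) (S_closed : closed S)
    (O : set 'rV[R]_n) (O_open : open O)
    (O_sub : O `<=` [set x | ~ S x /\ (min_time F S x < +oo)%E])
    (T_cont : {within O, continuous (min_time F S)}) :
  exists rho : 'rV[R]_n -> R,
    [/\ {within O, continuous rho},
        forall x, O x -> 0 < rho x
      & exterior_sphere_condition O (fun x => fine (min_time F S x)) rho].
Proof.
have [K1 K10 VL] := maximizer_lipschitz F hF1 hH2.
have [c0 c00 Hsc] := hH1.
pose K := K1 + c0 + 1; have K_ge1 : 1 <= K by rewrite /K; lra.
have unit_neq0 (N : 'rV[R]_n) : enorm N = 1 -> N != 0.
  by move=> N1; rewrite -enorm_gt0 N1.
have V_lip x y N : enorm N = 1 ->
    enorm (maximizer F x N - maximizer F y N) <= K * enorm (x - y).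
  move=> N1; apply: le_trans (VL x y N (unit_neq0 _ N1)) _.
  rewrite enormBC ler_wpM2r ?enorm_ge0 // /K; lra.
have V_max x N u : F x u -> dotv u N <= dotv (maximizer F x N) N.
  exact: (maximizerP F hF1 x N).2.
have V_ball x N u : enorm N = 1 ->
    enorm (u - (maximizer F x N - r *: N)) <= r -> F x u.
  exact: inner_ball_maximizer.
have ham_lip N x y : enorm N = 1 ->
    hamiltonian F x N - hamiltonian F y N <= K * enorm (x - y).
  move=> N1; rewrite !hamiltonianE // -dotvNl -dotvDl.
  apply: le_trans (cauchy_schwarz _ _) _; rewrite N1 mulr1; exact: V_lip.
have ham_support x N (eta : R) : enorm N = 1 -> 0 < eta <= 1 ->
    exists2 zeta, enorm zeta <= 3 * K & forall y,
    dotv (maximizer F x N) N + dotv zeta (y - x) - K * enorm (y - x) ^+ 2 - eta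
    <= dotv (maximizer F y N) N.
  move=> N1 /andP[eta0 eta1].
  have K0 : 0 <= K by lra.
  have := Hsc N; rewrite N1 mulr1 => scN.
  have [zeta hz] := semiconvex_support _ c0 K eta x c00 K0 eta0 scN (fun u v => ham_lip N u v N1).
  exists zeta; last first.
    move=> y; rewrite -!hamiltonianE //; apply: le_trans (hz y); rewrite lerB //.
    by rewrite lerB // ler_wpM2r ?sqr_ge0 // /K; lra.
  have [w w1 zE] := polar zeta N N1.
  have := hz (w + x); rewrite addrK w1 expr1n mulr1 {1}zE dotvZl -enorm_sqr w1.
  have := ham_lip N (w + x) x N1; rewrite addrK w1 /K; lra.
(* [F] is bounded at the origin and its support function is Lipschitz *)
have [B0 B0_ge0 hB0] : exists2 B0 : R, 0 <= B0 & forall u, F 0 u -> enorm u <= B0.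
  have [F0 _ Fc] := hF1 0.
  have [c Fc0 hc] := EVT_max_rV F0 Fc (continuous_subspaceT (@enorm_continuous R n)).
  exists (enorm c); first exact: enorm_ge0.
  by move=> u Fu; apply: hc; rewrite inE.
have F_growth x u (N0 : 'rV[R]_n) : enorm N0 = 1 -> F x u ->
    enorm u <= B0 + K * enorm x.
  move=> N01 Fu; have [N N1 uE] := polar u N0 N01.
  have uN : dotv u N = enorm u by rewrite {1}uE dotvZl -enorm_sqr N1 expr1n mulr1.
  have h1 := dotv_le_hamiltonian F hF1 x N u Fu.
  have h2 := ham_lip N x 0 N1; rewrite subr0 in h2.
  have h3 : hamiltonian F 0 N <= B0.
    rewrite hamiltonianE //; apply: le_trans (cauchy_schwarz _ _) _.
    by rewrite N1 mulr1; apply: hB0; exact: (maximizerP F hF1 0 N).1.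
  lra.
pose M (x : 'rV[R]_n) := B0 + K * (enorm x + 2) + r + 1.
have M_ge1 x : 1 <= M x.
  have := enorm_ge0 x => x_ge0; have : 0 <= K * (enorm x + 2) by rewrite mulr_ge0 //; lra.
  rewrite /M; lra.
have M_r x : r <= M x.
  have := enorm_ge0 x => x_ge0; have : 0 <= K * (enorm x + 2) by rewrite mulr_ge0 //; lra.
  rewrite /M; lra.
(* [x] differs from the points of [S], so the dimension is positive *)
have unit_vector x : O x -> exists N0 : 'rV[R]_n, enorm N0 = 1.
  move=> Ox; have [nSx _] := O_sub _ Ox; have [s Ss] := S_neq0.
  have d0 : s - x != 0 by apply/eqP => /subr0_eq sx; apply: nSx; rewrite -sx.
  exists ((enorm (s - x))^-1 *: (s - x)).
  by rewrite enormZ gtr0_norm ?invr_gt0 ?enorm_gt0 // mulVf // enorm_eq0.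
have F_bound x z u : O x -> enorm (z - x) <= 2 -> F z u -> enorm u <= M x.
  move=> /unit_vector[N0 N01] zx Fu; apply: (le_trans (F_growth _ _ _ N01 Fu)).
  have := enormD (z - x) x; rewrite subrK => h.
  have : K * enorm z <= K * (enorm x + 2) by rewrite ler_wpM2l //; lra.
  rewrite /M; lra.
pose T x := fine (min_time F S x).
have T_fin x : O x -> min_time F S x = (T x)%:E.
  move=> Ox; have [_ Tx] := O_sub _ Ox; rewrite fineK // ge0_fin_numE //.
  exact: min_time_ge0.
have T_gt0 x : O x -> 0 < T x.
  move=> Ox; have [nSx _] := O_sub _ Ox.
  have [||b b0] := min_time_gt0 F S (M x) x S_closed nSx.
  - by have := M_ge1 x; lra.
  - by move=> z u zx; apply: F_bound => //; lra.
  by rewrite T_fin // lee_fin; lra.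
(* [tau x] is at most [T x / 2] and at most [1 / (200 M K^2)] *)
pose tau x := T x / (2 + 200 * M x * K ^+ 2 * T x).
pose rho x := growth r (M x) * tau x / 4.
have den_gt0 x : O x -> 0 < 2 + 200 * M x * K ^+ 2 * T x.
  move=> Ox; have : 0 <= M x * K ^+ 2 * T x.
    rewrite mulr_ge0 ?(ltW (T_gt0 _ Ox)) // mulr_ge0 ?sqr_ge0 //.
    by have := M_ge1 x; lra.
  lra.
have tau_gt0 x : O x -> 0 < tau x by move=> Ox; rewrite divr_gt0 ?den_gt0 ?T_gt0.
have rho_gt0 x : O x -> 0 < rho x.
  by move=> Ox; rewrite divr_gt0 // mulr_gt0 ?tau_gt0 // growth_gt0.
exists rho; split=> //.
- apply/subspace_continuousP => x Ox.
  have FG : Filter (within O (nbhs x)) by exact: within_filter.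
  have cT : min_time F S @ within O (nbhs x) --> (T x)%:E.
    by rewrite -T_fin //; move/subspace_continuousP : T_cont; apply.
  have {}cT : T @ within O (nbhs x) --> T x by exact: fine_cvg cT.
  have cM : M @ within O (nbhs x) --> M x.
    have cn : enorm @ within O (nbhs x) --> enorm x.
      by apply: cvg_within_filter; exact: enorm_continuous.
    apply: cvgD; last exact: cvg_cst.
    apply: cvgD; last exact: cvg_cst.
    apply: cvgD; first exact: cvg_cst.
    apply: cvgM; first exact: cvg_cst.
    by apply: cvgD; [exact: cn|exact: cvg_cst].
  apply: cvg_radius => //; [exact: T_gt0|by have := M_ge1 x; lra|exact: sqr_ge0].
move=> x Ox; have [N0 N01] := unit_vector _ Ox.
have TK : 0 <= M x * K ^+ 2 * T x.
  rewrite mulr_ge0 ?(ltW (T_gt0 _ Ox)) // mulr_ge0 ?sqr_ge0 //.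
  by have := M_ge1 x; lra.
have Tx0 := T_gt0 _ Ox.
have [||nu nu1 hnu] := min_time_epi_ball F S K r (M x) x N0 K_ge1 (M_ge1 x) hr (M_r x)
  V_ball V_max V_lip (fun z u => F_bound x z u Ox) ham_support N01 (T x) (tau x) (T_fin _ Ox) (tau_gt0 _ Ox).
- rewrite /tau ler_pdivrMr ?den_gt0 //.
  have : T x * 0 <= T x * (M x * K ^+ 2 * T x) by rewrite ler_wpM2l // ltW.
  lra.
- rewrite /tau mulrA ler_pdivrMr ?den_gt0 //; lra.
rewrite -/(rho x) in hnu.
have rx := rho_gt0 _ Ox.
set X := graph_pt x (T x) in hnu *.
have nu0 : nu != 0 by rewrite -enorm_gt0 nu1.
have hypo : proximal_ineq (hypograph O T) X nu (enorm nu / (2 * rho x)).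
  move=> _ [y [b [Oy bT ->]]]; rewrite nu1 div1r leNgt; apply/negP => hlt.
  set D := graph_pt y b - X in hlt.
  pose e1 := graph_pt (0 : 'rV[R]_n) (1 : R).
  have e11 : enorm e1 = 1 by rewrite /enorm dotv_graph dotv0l add0r mulr1 sqrtr1.
  have inside : enorm (D - rho x *: nu) < rho x.
    rewrite -(ltr_pXn2r (n := 2)) ?nnegrE ?enorm_ge0 ?(ltW rx) // enorm_sqr.
    have nn : dotv nu nu = 1 by rewrite -enorm_sqr nu1 expr1n.
    have r2 : 0 < 2 * rho x by lra.
    rewrite enorm_sqr ltr_pdivrMl // in hlt.
    clearbody D; rewrite !dotvE nn (dotvC D nu); lra.
  (* lowering the point a little keeps it in the open ball, where [T y] is below
     its level *)
  pose s := (rho x - enorm (D - rho x *: nu)) / 2.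
  have s0 : 0 < s by rewrite /s; lra.
  have Ty : (min_time F S y <= (b - s)%:E)%E.
    apply: (hnu (graph_pt y (b - s))) => //.
    have -> : graph_pt y (b - s) - (X + rho x *: nu) = (D - rho x *: nu) - s *: e1.
      have -> : graph_pt y (b - s) = graph_pt y b - s *: e1.
        by rewrite !graph_ptE scaler0 subr0 mulr1.
      rewrite /D; generalize (graph_pt y b) X e1 => X1 X2 X3.
      by apply/rowP => i; rewrite !mxE; ring.
    apply: le_lt_trans (enormB _ _) _; rewrite enormZ e11 mulr1 gtr0_norm //.
    rewrite /s; lra.
  by move: Ty; rewrite T_fin // lee_fin; lra.
exists nu; split=> //.
split; first by exists x, (T x).
exists (enorm nu / (2 * rho x)) => //.
by rewrite divr_ge0 ?enorm_ge0 // mulr_ge0 // ltW.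
Qed.
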